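(* Let $D$ be a diagram of an oriented virtual link, with covering graph $\tilde D$. Then the canonical index cocycle $ci_D$ is cohomologous to the virtual index cocycle $vi_D$ in $C^1(\tilde D,\mathbb Z)$, i.e. there is a $0$-cochain $g\in C^0(\tilde D,\mathbb Z)$ with $ci_D-vi_D=\delta g$. In other words, $ci_D$ is a representative of the virtual index class $\iota_D=[vi_D]\in H^1(\tilde D,\mathbb Z)$.
   Context: An oriented virtual link diagram $D$ is a generic immersion of finitely many oriented circles into the oriented plane $\mathbb R^2$ (finitely many transversal double points), each double point being marked classical or virtual; at a classical crossing one strand is marked over and the other under. A long arc is an arc of $D$ between consecutive classical crossings (it may contain virtual crossings); a component without classical crossings is a closed long arc. The covering graph $\tilde D$ is the abstract graph whose vertices are the classical crossings and whose edges are the long arcs, oriented by $D$ (it is 4-valent and may have vertexless circle components). $C^1(\tilde D,\mathbb Z)$ is the group of integer functions on edges, and $(\delta g)(e)=g(\text{head of }e)-g(\text{tail of }e)$ for $g\in C^0(\tilde D,\mathbb Z)$ (zero on vertexless circles); every 1-cochain on the graph is a cocycle. Virtual index cocycle: $vi_D(e)$ is the sum over all passages of the long arc $e$ (traversed along its orientation) through virtual crossings of $+1$ if the other strand crosses from right to left and $-1$ if it crosses from left to right; a virtual self-crossing of $e$ is counted at both passages. Canonical index cocycle: at a classical crossing $c$ name the two strands $a,b$ so that (direction of $a$, direction of $b$) is a positive frame of $\mathbb R^2$. The cochain $\beta^l(c)$ is $-1$ on the edge of $a$ incoming to $c$, $+1$ on the edge of $b$ outgoing from $c$ (contributions are added if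 these are the same edge), and $0$ elsewhere. The cochain $\beta^r(c)$ is $+1$ on the incoming edge of $b$, $-1$ on the outgoing edge of $a$, and $0$ elsewhere. Then $ci_D=\sum_c\beta^l(c)=\sum_c\beta^r(c)$, the sums being over all classical crossings (the two sums are equal). *)

(* Defs.v *)
From mathcomp Require Import all_boot all_order all_algebra.
From mathcomp Require Import all_classical all_reals all_analysis.
From mathcomp Require Import ring.

Set Implicit Arguments.
Unset Strict Implicit.
Unset Printing Implicit Defensive.

Import Order.TTheory GRing.Theory Num.Theory numFieldNormedType.Exports.

Local Open Scope classical_set_scope.
Local Open Scope ring_scope.

(* An oriented graph possibly with vertexless circle components: an edge e has
   ends e = Some (tail, head), or None when e is a vertexless circle. *)
Record circle_graph := CircleGraph {
  vertex : Type;
  edge : Type;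
  ends : edge -> option (vertex * vertex) }.

Section Cochains.
Variable G : circle_graph.

Definition cochain0 := vertex G -> int.
Definition cochain1 := edge G -> int.

Definition coboundary (g : cochain0) : cochain1 := fun e =>
  if ends e is Some (tl, hd) then g hd - g tl else 0.

Definition cohomologous (u v : cochain1) : Prop :=
  exists g : cochain0, u - v = coboundary g.

(* The element of H^1(G, Z) = C^1 / im(delta) represented by u, as a coset:
   every 1-cochain is a cocycle. *)
Definition H1_class (u : cochain1) : set cochain1 :=
  [set v | cohomologous v u].

End Cochains.

Section Plane.
Variable R : realType.

(* (v, w) is a positive frame of the oriented plane iff 0 < det2 v w; in other
   words, w then points to the left of v. *)
Definition det2 (v w : R * R) : R := v.1 * w.2 - v.2 * w.1.

Definition smooth (f : R -> R) : Prop :=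
  forall (k : nat) (t : R), derivable (derive1n k f) t 1.

(* A circle is R/Z with its orientation by increasing parameter; n circles are
   mapped to the plane by 'I_n -> R -> R * R, 1-periodic in the parameter.  A
   point (i, t) of the i-th circle is represented by t in [0, 1[. *)
Section Curves.
Variables (n : nat) (curve : 'I_n -> R -> R * R).

Definition circle_point : set ('I_n * R) := [set P | 0 <= P.2 < 1].

Definition image_pt (P : 'I_n * R) : R * R := curve P.1 P.2.

Definition tangent (P : 'I_n * R) : R * R :=
  (derive1 (fun t => (curve P.1 t).1) P.2,
   derive1 (fun t => (curve P.1 t).2) P.2).

(* The ordered pairs of strands meeting at a double point. *)
Definition strand_pair (P Q : 'I_n * R) : Prop :=
  [/\ circle_point P, circle_point Q, P <> Q & image_pt P = image_pt Q].

Definition double_point : set (R * R) :=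
  [set c | exists P Q, strand_pair P Q /\ image_pt P = c].

Record generic_immersion : Prop := GenericImmersion {
  curve_periodic : forall i t, curve i (t + 1) = curve i t;
  curve_smooth : forall i,
    smooth (fun t => (curve i t).1) /\ smooth (fun t => (curve i t).2);
  curve_immersion : forall P, tangent P <> (0, 0);
  double_point_finite : finite_set double_point;
  double_point_transversal : forall P Q,
    strand_pair P Q -> det2 (tangent P) (tangent Q) != 0;
  no_triple_point : forall P Q S,
    strand_pair P Q -> strand_pair P S -> Q = S }.

End Curves.

(* The double points that are not classical are the virtual crossings.  The
   over/under marking selects the over-strand of every classical crossing; the
   value of over_strand elsewhere is irrelevant. *)
Record virtual_link_diagram := VirtualLinkDiagram {
  ncomp : nat;
  curve : 'I_ncomp -> R -> R * R;
  curve_generic : generic_immersion curve;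
  classical : set (R * R);
  classical_sub : classical `<=` double_point curve;
  over_strand : R * R -> 'I_ncomp * R;
  over_strandP : forall c, classical c ->
    circle_point (over_strand c) /\ image_pt curve (over_strand c) = c }.

End Plane.

Arguments circle_point {R n}.

Section Diagram.
Variables (R : realType) (D : virtual_link_diagram R).

Local Notation tan := (tangent (@curve R D)).
Local Notation pt := (image_pt (@curve R D)).

Definition virtual : set (R * R) := double_point (@curve R D) `\` classical D.

(* A long arc with endpoints: the part of a component from a classical crossing
   at parameter la_start to the next classical crossing at la_end.  Normalizing
   the start to [0, 1[ makes the representation unique; by periodicity
   la_end <= la_start + 1. *)
Record open_long_arc := OpenLongArc {
  la_comp : 'I_(ncomp D);
  la_start : R;
  la_end : R;
  la_start_bound : 0 <= la_start < 1;
  la_start_end : la_start < la_end;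
  la_tail : classical D (curve la_comp la_start);
  la_head : classical D (curve la_comp la_end);
  la_inner : forall t, la_start < t < la_end ->
    ~ classical D (curve la_comp t) }.

Record closed_long_arc := ClosedLongArc {
  ca_comp : 'I_(ncomp D);
  ca_inner : forall t, ~ classical D (curve ca_comp t) }.

Definition long_arc := (open_long_arc + closed_long_arc)%type.

Definition arc_comp (e : long_arc) : 'I_(ncomp D) :=
  match e with inl a => la_comp a | inr a => ca_comp a end.

Definition arc_start (e : long_arc) : R :=
  match e with inl a => la_start a | inr _ => 0 end.

Definition arc_end (e : long_arc) : R :=
  match e with inl a => la_end a | inr _ => 1 end.

Definition crossing := {c : R * R | classical D c}.

Definition arc_ends (e : long_arc) : option (crossing * crossing) :=
  match e with
  | inl a => Some (exist (classical D) _ (la_tail a),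
                   exist (classical D) _ (la_head a))
  | inr _ => None
  end.

Definition covering_graph : circle_graph :=
  @CircleGraph crossing long_arc arc_ends.

(* Parameters are compared modulo Z.  On a closed long arc the half-open
   interval counts the base point once; on an open one both ends are
   classical. *)
Definition on_arc (e : long_arc) (P : 'I_(ncomp D) * R) : Prop :=
  P.1 = arc_comp e /\ exists k : int, arc_start e <= P.2 + k%:~R < arc_end e.

(* The point P of a circle is the strand along which e leaves its tail, resp.
   arrives at its head.  Only used with P above a classical crossing; it is then
   false for a closed long arc. *)
Definition leaves_along (P : 'I_(ncomp D) * R) (e : long_arc) : Prop :=
  P.1 = arc_comp e /\ exists k : int, P.2 + k%:~R = arc_start e.

Definition arrives_along (P : 'I_(ncomp D) * R) (e : long_arc) : Prop :=
  P.1 = arc_comp e /\ exists k : int, P.2 + k%:~R = arc_end e.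

(* The passages of e through virtual crossings: P is the passage along e and Q
   the other strand. *)
Definition virtual_passage (e : long_arc) :
    set (('I_(ncomp D) * R) * ('I_(ncomp D) * R)) :=
  [set PQ | [/\ strand_pair (@curve R D) PQ.1 PQ.2,
                virtual (pt PQ.1) & on_arc e PQ.1]].

Definition virtual_index : cochain1 covering_graph := fun e =>
  \sum_(PQ \in virtual_passage e) sgz (det2 (tan PQ.1) (tan PQ.2)).

(* The two strands a, b at c named so that their directions form a positive
   frame. *)
Definition strands_at (c : R * R) (a b : 'I_(ncomp D) * R) : Prop :=
  [/\ strand_pair (@curve R D) a b, pt a = c & 0 < det2 (tan a) (tan b)].

Definition edge_in_a (c : R * R) : set long_arc :=
  [set e | exists a b, strands_at c a b /\ arrives_along a e].
Definition edge_out_a (c : R * R) : set long_arc :=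
  [set e | exists a b, strands_at c a b /\ leaves_along a e].
Definition edge_in_b (c : R * R) : set long_arc :=
  [set e | exists a b, strands_at c a b /\ arrives_along b e].
Definition edge_out_b (c : R * R) : set long_arc :=
  [set e | exists a b, strands_at c a b /\ leaves_along b e].

Definition beta_l (c : R * R) : cochain1 covering_graph := fun e =>
  - \1_(edge_in_a c) e + \1_(edge_out_b c) e.

Definition beta_r (c : R * R) : cochain1 covering_graph := fun e =>
  \1_(edge_in_b c) e - \1_(edge_out_a c) e.

Definition canonical_index : cochain1 covering_graph := fun e =>
  \sum_(c \in classical D) beta_l c e.

Definition virtual_index_class : set (cochain1 covering_graph) :=
  H1_class virtual_index.

End Diagram.

Arguments virtual_index {R} D.
Arguments canonical_index {R} D.
Arguments virtual_index_class {R} D.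

Section CanonicalIndexSym.
Variables (R : realType) (D : virtual_link_diagram R).

Local Notation tan := (tangent (@curve R D)).
Local Notation pt := (image_pt (@curve R D)).
Local Notation spair := (strand_pair (@curve R D)).

Lemma det2C (v w : R * R) : det2 v w = - det2 w v.
Proof. by rewrite /det2 opprB mulrC [w.1 * _]mulrC. Qed.

Lemma curve_nat i (t : R) (k : nat) : curve (v := D) i (t + k%:R) = curve i t.
Proof.
elim: k => [|k IH]; first by rewrite addr0.
by rewrite -addn1 natrD addrA (curve_periodic (curve_generic D)).
Qed.

Lemma curve_int i (t : R) (k : int) : curve (v := D) i (t + k%:~R) = curve i t.
Proof.
case: k => k; first exact: curve_nat.
rewrite NegzE rmorphN /= -pmulrn.
by have := curve_nat i (t - k.+1%:R) k.+1; rewrite subrK => ->.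
Qed.

Lemma strand_pair_sym P Q : spair P Q -> spair Q P.
Proof. by case=> cP cQ PQ e; split=> // /esym. Qed.

Let frac (i : 'I_(ncomp D)) (t : R) := (i, t - (Num.floor t)%:~R).

Lemma frac_circle i t : circle_point (frac i t).
Proof.
rewrite /circle_point /frac /= subr_ge0 floor_le /=.
by rewrite ltrBlDr addrC -[1]/(1%:~R) -rmorphD /= floorD1_gt.
Qed.

Lemma fracP i t P : circle_point P ->
  (P.1 = i /\ exists k : int, P.2 + k%:~R = t) <-> P = frac i t.
Proof.
case: P => j u; rewrite /circle_point /= => /andP[u0 u1]; split.
  case=> -> [k <-]; congr pair.
  suff -> : Num.floor (u + k%:~R) = k by rewrite addrK.
  by apply/eqP; rewrite floor_eq lerDr u0 rmorphD /= addrC ltrD2l.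
by case=> -> ->; split=> //; exists (Num.floor t); rewrite subrK.
Qed.

Lemma pt_frac i t : pt (frac i t) = curve i t.
Proof. by rewrite /image_pt /frac /= -rmorphN curve_int. Qed.

Lemma strands_sum (L : 'I_(ncomp D) * R -> Prop) P0 c :
  circle_point P0 -> (forall P, circle_point P -> L P <-> P = P0) ->
  classical D c ->
  (`[< exists a b, strands_at c a b /\ L a >] : nat) +
  (`[< exists a b, strands_at c a b /\ L b >] : nat) = (pt P0 == c) :> nat.
Proof.
move=> cP0 LP Cc; have gen := curve_generic D.
case: (eqVneq (pt P0) c) => [e|ne]; last first.
  by rewrite !asboolF //; case=> a [b [[[ca cb _ ab] ac _]]] /LP h;
    move: ne; rewrite -h// -?ab ac eqxx.
have [X [Y [XY Xc]]] := classical_sub Cc.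
have [Q PQ] : exists Q, spair P0 Q.
  case: (pselect (P0 = X)) => [->|nX]; first by exists Y.
  exists X; apply: strand_pair_sym; case: XY => cX _ _ _.
  by split=> //; [move=> /esym|rewrite Xc e].
have cQ : circle_point Q by case: PQ.
have Qc : pt Q = c by case: PQ => _ _ _ <-.
have LP0 : L P0 by apply/LP.
have excl a b a' b' : strands_at c a b -> strands_at c a' b' -> L a -> L b' ->
    False.
  case=> ab _ d [ab' _ d'] La Lb'.
  have [ca _ _ _] := ab; have [_ cb' _ _] := ab'.
  have E : b' = a by rewrite (LP _ cb').1 // (LP _ ca).1.
  subst b'.
  have E := no_triple_point gen ab (strand_pair_sym ab'); subst a'.
  by move: d'; rewrite det2C oppr_gt0 ltNge ltW.
have := double_point_transversal gen PQ; case: ltgtP => // d _.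
- rewrite asboolF ?asboolT //.
    by exists Q, P0; split=> //; split=> //;
      [exact: strand_pair_sym|rewrite det2C oppr_gt0].
  case=> a [b [S La]]; apply: (excl _ _ Q P0 S _ La LP0).
  by split; [exact: strand_pair_sym| |rewrite det2C oppr_gt0].
- rewrite asboolT ?asboolF //.
    by case=> a [b [S Lb]]; apply: (excl P0 Q _ _ _ S LP0 Lb); split.
  by exists P0, Q; split.
Qed.

Lemma canonical_index_r e :
  canonical_index D e = \sum_(c \in classical D) beta_r c e.
Proof.
have fin : finite_set (classical D).
  exact: (sub_finite_set (@classical_sub _ D)
    (double_point_finite (curve_generic D))).
rewrite /canonical_index !fsbig_finite //=; apply/eqP.
rewrite -subr_eq0 -sumrB.
have split_lr c : beta_l c e - beta_r c e =
    (\1_(edge_out_a c) e + \1_(edge_out_b c) e) -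
    (\1_(edge_in_a c) e + \1_(edge_in_b c) e).
  rewrite /beta_l /beta_r; ring.
under eq_bigr do rewrite split_lr.
rewrite sumrB.
have key (L : 'I_(ncomp D) * R -> long_arc D -> Prop) (i : 'I_(ncomp D)) t :
  (forall P, L P e <-> P.1 = i /\ exists k : int, P.2 + k%:~R = t) ->
  \sum_(c <- finmap.enum_fset (fset_set (classical D)))
   ((\1_[set x | exists a b, strands_at c a b /\ L a x] e : int) +
    \1_[set x | exists a b, strands_at c a b /\ L b x] e) =
  (`[< classical D (curve i t) >])%:R.
  move=> LE; set s := finmap.enum_fset _.
  have sE c : (c \in s) = `[< classical D c >].
    have := in_fset_set fin c; rewrite -[X in X = _]/(c \in s) => ->.
    by apply/idP/asboolP; rewrite in_setE.
  transitivity (\sum_(c <- s) ((curve i t == c)%:R : int)).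
    apply: eq_big_seq => c; rewrite sE => /asboolP Cc.
    rewrite !indicE -natrD; congr (_%:R).
    rewrite -(pt_frac i t) -(@strands_sum (L^~ e) (frac i t) c) //.
    - exact: frac_circle.
    - by move=> P cP; rewrite LE; apply: fracP.
  rewrite -sE -natr_sum; congr (_%:R).
  rewrite -(count_uniq_mem _ (finmap.fset_uniq _)) -sum1_count [RHS]big_mkcond /=.
  by apply: eq_bigr => c _; rewrite eq_sym; case: eqP.
rewrite (key (@leaves_along R D) (arc_comp e) (arc_start e)) //.
rewrite (key (@arrives_along R D) (arc_comp e) (arc_end e)) //.
case: e {split_lr key} => a /=.
  by rewrite (asboolT (la_tail a)) (asboolT (la_head a)) subrr.
by rewrite !asboolF ?subrr //; apply: ca_inner.
Qed.

End CanonicalIndexSym.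

(* Main.v *)
Require Import Defs.
From mathcomp Require Import all_boot all_order all_algebra.
From mathcomp Require Import all_classical all_reals all_analysis.
From mathcomp Require Import ring lra.

Set Implicit Arguments.
Unset Strict Implicit.
Unset Printing Implicit Defensive.

Import Order.TTheory GRing.Theory Num.Theory numFieldNormedType.Exports.

Local Open Scope classical_set_scope.
Local Open Scope ring_scope.

(** Let w(p) be the sum over the components of the winding numbers around p.  It
is defined off the diagram, and when p runs along a component, the regions to
its left and to its right change only at crossings.  Extend w to the diagram by
averaging over the adjacent regions: two on a strand, four at a crossing.  If
the moving point meets a strand that crosses from right to left, the extended
function W goes down by one half on arriving at the crossing, and by another
half on leaving it; if the strand crosses from left to right, it goes up.
Hence, along a long arc e,

   W(head of e) - W(tail of e)
     = - (signs of the virtual passages of e) - (half the signs at its two ends).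

The first term is - vi(e).  Averaging the two expressions beta^l and beta^r of
the canonical index shows that the second one is ci(e).  So ci - vi = delta W,
and since ci - vi is integral, the integer part of W is a 0-cochain with the
same coboundary.

The averages need not be taken by hand.  Let p be a point and ga a component.
The direction of the line through p and ga(v), unlike that of the vector
ga(v) - p, depends continuously on v even if ga passes through p, provided that
the tangent line is taken there.  Twice its total turning is 4 pi times
the winding number if p is off ga, and 4 pi times the average otherwise.  Here
the direction of a line is encoded by the doubled angle of its vectors;
turning is the net change of a continuous lift of this doubled angle, and
mean_winding is the sum of the turnings divided by 4 pi.

Two local statements about turning carry the proof.  By turning_stable it is
locally constant while the point moves along a strand of ga itself or away
from ga: the line of sight then depends continuously on both parameters, by
the mean value theorem along the diagonal.  By turning_jump it changes by 2 pi
when the point leaves a transversal strand.  Both are proved by estimates, since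
the turning is a multiple of 2 pi: it is enough to know it with an error less
than 2 pi.

To go from local to global, the jumps are compensated by step functions of the
parameter, which makes the sum locally constant, hence constant: this is
winding_along.  The lemmas step_along_arc, virtual_index_sum and
canonical_index_sum then evaluate the steps at the ends of an arc. *)

(** * Angles and their lifts *)

Section Angles.
Variable R : realType.
Implicit Types (a b x y : R) (f th : R -> R).

(** An interval of length pi contains a point where the cosine is not positive. *)
Lemma cos_gt0_dist f a b : (forall v, a <= v <= b -> {for v, continuous f}) -> a <= b ->
  (forall v, a <= v <= b -> 0 < cos (f v)) -> `|f b - f a| < pi.
Proof.
move=> cf ab pos; rewrite ltNge; apply/negP => far.
have no_value y : cos y <= 0 -> ~ (Num.min (f a) (f b) <= y <= Num.max (f a) (f b)).
  move=> y0 yab; have [|v vab fv] := IVT ab _ yab.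
    by apply: continuous_in_subspaceT => v; rewrite inE /= in_itv; exact: cf.
  by have := pos v; rewrite -fv in y0; move: vab; rewrite in_itv /= => -> /(_ isT);
    rewrite ltNge y0.
have p0 := @pi_gt0 R.
have ca : 0 < cos (f a) by apply: pos; rewrite lexx.
have [le_ab|lt_ba] := lerP (f a) (f b).
  apply: (no_value (f a + pi)); first by rewrite cosDpi oppr_le0 ltW.
  move: far; rewrite ger0_norm ?subr_ge0 // (min_idPl le_ab) (max_idPr le_ab).
  move=> h; lra.
apply: (no_value (f a - pi)).
  by have := cosDpi (f a - pi); rewrite subrK => e; lra.
move: far; rewrite ltr0_norm ?subr_lt0 // (min_idPr (ltW lt_ba)) (max_idPl (ltW lt_ba)).
move=> h; lra.
Qed.

Lemma cos1_eq0 x : cos x = 1 -> `|x| < pi *+ 2 -> x = 0.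
Proof.
move=> c1 lt2pi; apply/eqP; rewrite -normr_eq0; apply/negPn/negP => x0.
have : 0 < sin (`|x| / 2).
  apply: sin_gt0_pi; have : 0 < `|x| by rewrite lt_def x0 normr_ge0.
  by move: lt2pi; rewrite mulr2n => h1 h2; apply/andP; split; lra.
suff -> : sin (`|x| / 2) = 0 by rewrite ltxx.
have : cos (`|x|) = 1 by rewrite cos_norm.
rewrite [in cos _](_ : `|x| = (`|x| / 2) *+ 2); last by rewrite mulr2n; lra.
rewrite cos_mulr2n cos2sin2 => h.
by apply/eqP; rewrite -sqrf_eq0; apply/eqP; rewrite mulr2n in h; lra.
Qed.

Lemma cos1_constant f a b : (forall v, a <= v <= b -> {for v, continuous f}) -> a <= b ->
  (forall v, a <= v <= b -> cos (f v) = 1) -> f a = f b.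
Proof.
move=> cf ab c1; apply/esym/eqP; rewrite -subr_eq0; apply/eqP.
have sin0 v : a <= v <= b -> sin (f v) = 0.
  by move=> /c1 h; apply: cos1sin0; rewrite h normr1.
apply: cos1_eq0.
  by rewrite cosB !(c1, sin0) ?lexx ?ab //; lra.
apply: lt_trans (_ : pi < _).
  by apply: cos_gt0_dist => // v /c1 ->.
by rewrite mulr2n ltrDl pi_gt0.
Qed.

(** The tangent of the half angle of (x, y) is y / (1 + x).  This gives a continuous
choice of the angle on the unit circle minus the point (-1, 0). *)
Lemma half_angle x y : x ^+ 2 + y ^+ 2 = 1 -> x != -1 ->
  cos (atan (y / (1 + x)) *+ 2) = x /\ sin (atan (y / (1 + x)) *+ 2) = y.
Proof.
move=> xy xN1; have x1 : 1 + x != 0 by rewrite addrC addr_eq0.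
have [/cos_gt0_pihalf ca ta] := atan_def (y / (1 + x)).
have := cos2_tan2 (lt0r_neq0 ca); rewrite ta.
set A := atan _ in ca ta *; have cA0 := lt0r_neq0 ca.
have sA : sin A = y / (1 + x) * cos A by rewrite -ta /tan divfK.
have xy' : y ^+ 2 = (1 - x) * (1 + x).
  by rewrite -[LHS](addKr (x ^+ 2)) xy; ring.
have -> : 1 + (y / (1 + x)) ^+ 2 = 2 / (1 + x).
  rewrite expr_div_n xy'; field; exact: x1.
move=> h; have c2 : cos A ^+ 2 = (1 + x) / 2.
  by rewrite -[LHS]invrK h invf_div.
rewrite cos_mulr2n sin_mulr2n sA c2 mulr2n; split; first by field.
by rewrite mulrCA -expr2 c2 mulr2n; field.
Qed.

(** The lifts live on a bounded interval, where uniform continuity yields them. *)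
Definition lifts th (c s : R -> R) (L : R) := forall v, `|v| <= L ->
  [/\ {for v, continuous th}, cos (th v) = c v & sin (th v) = s v].

Lemma norm_le_of_itv (L a b v : R) : - L <= a -> b <= L -> a <= v <= b -> `|v| <= L.
Proof. by move=> La bL /andP[? ?]; rewrite ler_norml; apply/andP; split; lra. Qed.

(** The squared inner product of two unit vectors exceeds 1/2 when the lines that
they span make an angle less than pi / 4.  The difference of the lifts then
stays in an interval of length pi / 2 around a multiple of pi. *)
Lemma lift_dist th1 th2 c1 s1 c2 s2 L a b : a <= b -> - L <= a -> b <= L ->
  lifts th1 c1 s1 L -> lifts th2 c2 s2 L ->
  (forall v, a <= v <= b -> 1 / 2 < (c1 v * c2 v + s1 v * s2 v) ^+ 2) ->
  `|(th1 b - th2 b) - (th1 a - th2 a)| < pi / 2.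
Proof.
move=> ab La bL t1 t2 near.
have cf v : a <= v <= b ->
    {for v, continuous (fun v => (th1 v - th2 v) + (th1 v - th2 v))}.
  move=> /(norm_le_of_itv La bL) vL; have [k1 _ _] := t1 v vL; have [k2 _ _] := t2 v vL.
  have cd := continuousB k1 k2; exact: (continuousD cd cd).
have := cos_gt0_dist cf ab; rewrite -!mulr2n -mulrnBl normrMn mulr2n.
move=> h; suff : forall v, a <= v <= b -> 0 < cos ((th1 v - th2 v) + (th1 v - th2 v)).
  by move=> /h; set w := `| _ |; lra.
move=> v vab; have vL := norm_le_of_itv La bL vab.
rewrite -mulr2n cos_mulr2n cosB; have [_ -> ->] := t1 v vL; have [_ -> ->] := t2 v vL.
have := near v vab; set w := (X in X ^+ 2 *+ 2).
by rewrite -(mulr_natr (w ^+ 2)) -/w; lra.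
Qed.

Lemma sin_gt0_cos_lt0_dist x : - pi < x < pi -> 0 < sin x -> cos (x *+ 2) < 0 ->
  `|x - pi / 2| < pi / 4.
Proof.
move=> /andP[x1 x2] sx cx; have p0 := @pi_gt0 R; rewrite mulr2n in cx.
have x0 : 0 < x.
  rewrite ltNge; apply/negP => x0.
  have := @sin_ge0_pi _ (- x) ltac:(apply/andP; split; lra).
  by rewrite sinN; lra.
rewrite ltNge; apply/negP; rewrite ler_normr => /orP[] h.
  have := @cos_ge0_pihalf _ (x + x - pi *+ 2); rewrite cosB cos2pi sin2pi.
  by move=> /(_ ltac:(apply/andP; split; lra)); lra.
by have := @cos_ge0_pihalf _ (x + x) ltac:(apply/andP; split; lra); lra.
Qed.


(** While (x, y) moves from near the negative x-axis to near the positive one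
avoiding the nonnegative y-axis, it turns counterclockwise by about pi.  The lift
th belongs to the doubled angle of (x, y), so it increases by about 2 pi. *)
Lemma lift_jump th c s L (x y : R -> R) u w : u <= w -> - L <= u -> w <= L ->
  lifts th c s L -> continuous x -> continuous y ->
  (forall v : R, u <= v <= w -> x v = 0 -> y v < 0) ->
  (forall v : R, u <= v <= w -> c v * (x v ^+ 2 + y v ^+ 2) = x v ^+ 2 - y v ^+ 2) ->
  (forall v : R, u <= v <= w -> s v * (x v ^+ 2 + y v ^+ 2) = (x v * y v) *+ 2) ->
  `|y u| < - x u -> `|y w| < x w ->
  `|th w - th u - pi *+ 2| < pi.
Proof.
move=> uw Lu wL hth cx cy xy0 cE sE yu yw.
pose m v := Num.sqrt (x v ^+ 2 + y v ^+ 2).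
(* The angle of (x, y) counted from the negative y-axis; it is continuous because
   the opposite direction is avoided. *)
pose al v := atan (x v / (m v - y v)) *+ 2.
have m2 v : m v ^+ 2 = x v ^+ 2 + y v ^+ 2.
  by rewrite sqr_sqrtr // addr_ge0 ?sqr_ge0.
have my v : u <= v <= w -> 0 < m v /\ 0 < m v - y v.
  move=> vuw; have m0 : 0 <= m v by exact: sqrtr_ge0.
  have := m2 v; have := xy0 v vuw; case: (eqVneq (x v) 0) => [-> /(_ erefl) yv h|xv _ h].
    split; last by lra.
    by rewrite lt_def m0 andbT; apply: contraTN yv => /eqP E; move: h; rewrite E; nra.
  have x2 : 0 < x v ^+ 2 by rewrite lt_def sqr_ge0 sqrf_eq0 xv.
  by split; nra.
have alE v : u <= v <= w -> cos (al v) = - y v / m v /\ sin (al v) = x v / m v.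
  move=> /my[mv myv]; have m0 := lt0r_neq0 mv; have my0 := lt0r_neq0 myv.
  have E : x v / (m v - y v) = (x v / m v) / (1 + - y v / m v).
    by field; rewrite m0 my0.
  rewrite /al E; apply: half_angle.
    by rewrite !expr_div_n m2 sqrrN -mulrDl addrC divff // -m2 expf_neq0.
  by apply/eqP => h; have := divfK m0 (- y v); rewrite h; lra.
have cm v : {for v, continuous m}.
  apply: continuous_comp; last exact: sqrt_continuous.
  by apply: continuousD; [exact: (continuousM (cx v) (cx v))|exact: (continuousM (cy v) (cy v))].
have ca v : u <= v <= w -> {for v, continuous al}.
  move=> /my[_ /lt0r_neq0 my0].
  have ch : {for v, continuous (fun v => atan (x v / (m v - y v)))}.
    apply: continuous_comp; last exact: continuous_atan.
    apply: continuousM; first exact: cx.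
    apply: continuousV => //; apply: continuousB; [exact: cm|exact: cy].
  have -> : al = fun v => atan (x v / (m v - y v)) + atan (x v / (m v - y v)).
    by apply/funext => z; rewrite /al mulr2n.
  exact: continuousD.
have cd v : u <= v <= w -> {for v, continuous (fun v => th v - (al v + al v - pi))}.
  move=> vuw; have [cth _ _] := hth v (norm_le_of_itv Lu wL vuw).
  apply: continuousB; first exact: cth.
  apply: continuousB; last exact: cvg_cst.
  by apply: continuousD; apply: ca.
(* The angle counted from the x-axis is al - pi / 2; its double is 2 al - pi. *)
have al_lift : th u - (al u + al u - pi) = th w - (al w + al w - pi).
  apply: (cos1_constant cd uw) => v vuw.
  have vL := norm_le_of_itv Lu wL vuw.
  have [mv _] := my v vuw; have m0 := lt0r_neq0 mv.
  have [cal sal] := alE v vuw.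
  rewrite cosB; have [_ -> ->] := hth v vL.
  have mm : x v ^+ 2 + y v ^+ 2 != 0 by rewrite -m2 expf_neq0.
  have -> : cos (al v + al v - pi) = c v.
    apply: (mulIf mm); rewrite cE // cosB cosD cospi sinpi cal sal -m2.
    by rewrite -[in RHS](mulfK (expf_neq0 2 m0) (x v ^+ 2)); field.
  have -> : sin (al v + al v - pi) = s v.
    apply: (mulIf mm); rewrite sE // sinB sinD cospi sinpi cal sal -m2.
    by rewrite mulr2n; field.
  have [_ <- <-] := hth v vL; rewrite -!expr2; exact: cos2Dsin2.
have al_bound v : u <= v <= w -> - pi < al v < pi.
  by move=> _; rewrite /al mulr2n; have := @atan_gtNpi2 _ (x v / (m v - y v));
    have := @atan_ltpi2 _ (x v / (m v - y v)) => ? ?; apply/andP; split; lra.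
(* The sign e treats both ends at once: e = -1 at u and e = 1 at w. *)
have dist_al v (e : R) : u <= v <= w -> e ^+ 2 = 1 -> 0 < e * x v -> `|y v| < e * x v ->
    `|e * al v - pi / 2| < pi / 4.
  move=> vuw e2 ex yex; have [mv _] := my v vuw; have m0 := lt0r_neq0 mv.
  have [cal sal] := alE v vuw; have bal := al_bound v vuw.
  have e1 : e = 1 \/ e = -1 by apply/pred2P; rewrite -sqrf_eq1 e2.
  have s0 : 0 < e * sin (al v) by rewrite sal mulrA divr_gt0.
  have c0 : cos (al v *+ 2) < 0.
    rewrite cos_mulr2n -[1](cos2Dsin2 (al v)) cal sal !expr_div_n sqrrN.
    suff : y v ^+ 2 / m v ^+ 2 < x v ^+ 2 / m v ^+ 2.
      set p := _ / _; set q := _ / _; rewrite -(mulr_natr p); lra.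
    rewrite ltr_pM2r ?invr_gt0 ?exprn_gt0 // -(real_normK (num_real (y v))).
    rewrite -[x v ^+ 2]mul1r -e2 -exprMn ltrXn2r //; exact: le_lt_trans yex.
  apply: sin_gt0_cos_lt0_dist; case: e1 s0 => ->; rewrite ?mul1r ?mulN1r ?sinN //.
    by move=> _; move: bal => /andP[? ?]; apply/andP; split; lra.
  by rewrite mulNrn cosN.
have uu : u <= u <= w by rewrite lexx.
have ww : u <= w <= w by rewrite lexx andbT.
have := dist_al u (-1) uu; have := dist_al w 1 ww; rewrite !mulN1r !mul1r expr1n sqrrN expr1n.
have := normr_ge0 (y u); have := normr_ge0 (y w).
move=> yw0 yu0 /(_ erefl (le_lt_trans yw0 yw) yw) aw /(_ erefl (le_lt_trans yu0 yu) yu) au.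
move: aw au; rewrite !ltr_norml => /andP[? ?] /andP[? ?]; apply/andP; split; lra.
Qed.

Lemma segment_uniformly (a b t0 : R) (P : R -> R -> Prop) :
  (forall v, a <= v <= b -> \forall v' \near v & t \near t0, P t v') ->
  exists2 e, 0 < e & forall t, `|t - t0| < e -> forall v, a <= v <= b -> P t v.
Proof.
move=> loc; have /compact_near_coveringP cover := @segment_compact R a b.
have := cover R (nbhs t0) P _ => /(_ (nbhs_filter _)) /(_ _)/wrap[].
  by move=> v; rewrite /= in_itv; exact: loc.
move=> /nbhs_ballP[e /= e0 he]; exists e => // t te v vab.
by apply: he; rewrite /= ?in_itv // /ball /= distrC.
Qed.

(** As complex numbers, the vector at v is the vector at 0 times the product of the
quotients of the vectors at v (k + 1) / N and v k / N, for k < N.  If N is large,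
no quotient is -1, so each has a continuous angle, and the lift is their sum. *)
Lemma lift_exists (c s : R -> R) (L : R) : continuous c -> continuous s ->
  (forall v, c v ^+ 2 + s v ^+ 2 = 1) -> exists th, lifts th c s L.
Proof.
move=> cc cs cs1.
have [N N0 near_step] : exists2 N, (0 < N)%N & forall (v : R) k, `|v| <= L -> (k < N)%N ->
    -1 < c (v * k.+1%:R / N%:R) * c (v * k%:R / N%:R) +
         s (v * k.+1%:R / N%:R) * s (v * k%:R / N%:R).
  have [|e e0 he] := @segment_uniformly (- L) L 0
      (fun d v => -1 < c (v + d) * c v + s (v + d) * s v).
    move=> v _.
    have cont : {for (v, 0), continuous
        (fun vd : R * R => c (vd.1 + vd.2) * c vd.1 + s (vd.1 + vd.2) * s vd.1)}.
      have c1 : {for (v, 0 : R), continuous (fun vd : R * R => vd.1)} by exact: cvg_fst.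
      have c2 : {for (v, 0 : R), continuous (fun vd : R * R => vd.2)} by exact: cvg_snd.
      have c12 := continuousD c1 c2.
      apply: continuousD; apply: continuousM.
      - exact: (continuous_comp c12 (cc _)).
      - exact: (continuous_comp c1 (cc _)).
      - exact: (continuous_comp c12 (cs _)).
      - exact: (continuous_comp c1 (cs _)).
    by apply: (cvgr_gt _ cont); rewrite /= addr0 -!expr2 cs1; lra.
  exists (Num.bound `|L / e|).+1 => // v k vL kN.
  set M : R := (Num.bound _).+1%:R; pose u := v * k%:R / M.
  have M0 : 0 < M by rewrite ltr0n.
  have LM : L / M < e.
    rewrite ltr_pdivrMr // mulrC -ltr_pdivrMr //.
    apply: le_lt_trans (ler_norm _) (lt_trans (archi_boundP (normr_ge0 _)) _).
    by rewrite ltr_nat.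
  have wE : v * k.+1%:R / M = u + v / M by rewrite /u -natr1 mulrDr mulr1 mulrDl.
  have d_lt : `|v / M - 0| < e.
    rewrite subr0 normrM normfV (gtr0_norm M0).
    by apply: le_lt_trans LM; rewrite ler_pM2r ?invr_gt0.
  rewrite wE -/u; apply: he => //; rewrite -ler_norml /u -mulrA normrM.
  rewrite -[L]mulr1; apply: ler_pM => //.
  by rewrite ger0_norm ?divr_ge0 // ler_pdivrMr // mul1r ler_nat ltnW.
pose re k v := c (v * k.+1%:R / N%:R) * c (v * k%:R / N%:R) +
               s (v * k.+1%:R / N%:R) * s (v * k%:R / N%:R).
pose im k v := s (v * k.+1%:R / N%:R) * c (v * k%:R / N%:R) -
               c (v * k.+1%:R / N%:R) * s (v * k%:R / N%:R).
have cmul (a b v : R) : {for v, continuous (fun v : R => v * a / b)}.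
  by apply: continuousM; [apply: continuousM|]; [exact: cvg_id|exact: cvg_cst|exact: cvg_cst].
have cscale (f : R -> R) (a b v : R) : continuous f -> {for v, continuous (fun v : R => f (v * a / b))}.
  by move=> cf; exact: (continuous_comp (cmul a b v) (cf _)).
have cre k : continuous (re k).
  by move=> v; apply: (continuousD (continuousM _ _) (continuousM _ _)); exact: cscale.
have cim k : continuous (im k).
  by move=> v; apply: (continuousB (continuousM _ _) (continuousM _ _)); exact: cscale.
pose d k v := atan (im k v / (1 + re k v)) *+ 2.
have [th0 cth0 sth0] : exists2 th0, cos th0 = c 0 & sin th0 = s 0.
  have [c0|c0] := eqVneq (c 0) (-1).
    exists pi; rewrite ?cospi ?sinpi ?c0 //; apply/esym/eqP; rewrite -sqrf_eq0.
    by have := cs1 0; rewrite c0 sqrrN expr1n => h; apply/eqP; lra.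
  by have [? ?] := half_angle (cs1 0) c0; exists (atan (s 0 / (1 + c 0)) *+ 2).
exists (fun v => th0 + \sum_(k < N) d k v) => v vL.
have re_gt k : (k < N)%N -> -1 < re k v by exact: near_step.
have dE k : (k < N)%N -> cos (d k v) = re k v /\ sin (d k v) = im k v.
  move=> kN; apply: half_angle; last by rewrite gt_eqF ?re_gt.
  transitivity ((c (v * k.+1%:R / N%:R) ^+ 2 + s (v * k.+1%:R / N%:R) ^+ 2) *
                (c (v * k%:R / N%:R) ^+ 2 + s (v * k%:R / N%:R) ^+ 2)).
    by rewrite /re /im; ring.
  by rewrite !cs1 mulr1.
have step n : (n <= N)%N -> cos (th0 + \sum_(k < n) d k v) = c (v * n%:R / N%:R) /\
              sin (th0 + \sum_(k < n) d k v) = s (v * n%:R / N%:R).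
  elim: n => [_|n IH nN]; first by rewrite big_ord0 addr0 mulr0 mul0r.
  have [IHc IHs] := IH (ltnW nN).
  rewrite big_ord_recr /= addrA; set A := th0 + _ in IHc IHs *.
  rewrite (cosD A) (sinD A) IHc IHs; have [-> ->] := dE n nN.
  have := cs1 (v * n%:R / N%:R); rewrite /re /im.
  move: (c (v * n%:R / N%:R)) (s (v * n%:R / N%:R)) => x y E.
  move: (c _) (s _) => x1 y1.
  split; [transitivity (x1 * (x ^+ 2 + y ^+ 2))|transitivity (y1 * (x ^+ 2 + y ^+ 2))];
    by [ring|rewrite E mulr1].
split.
- suff cdk k : (k < N)%N -> {for v, continuous (d k)}.
    apply: continuousD; first exact: cvg_cst.
    have : (N <= N)%N by [].
    elim: {-2}N => [_|n IH nN].
      have -> : (fun z => \sum_(k < 0) d k z) = cst 0.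
        by apply/funext => z; rewrite big_ord0.
      exact: cvg_cst.
    have -> : (fun z => \sum_(k < n.+1) d k z) = (fun z => \sum_(k < n) d k z + d n z).
      by apply/funext => z; rewrite big_ord_recr.
    by apply: continuousD; [exact: IH (ltnW nN)|exact: cdk].
  move=> kN.
  have cd : {for v, continuous (fun v => atan (im k v / (1 + re k v)))}.
    apply: continuous_comp; last exact: continuous_atan.
    apply: continuousM; first exact: cim.
    apply: continuousV; last by apply: continuousD; [exact: cvg_cst|exact: cre].
    by have := near_step v k vL kN; rewrite -/(re k v) => h; apply: lt0r_neq0; lra.
  have -> : d k = fun v => atan (im k v / (1 + re k v)) + atan (im k v / (1 + re k v)).
    by apply/funext => z; rewrite /d mulr2n.
  exact: continuousD.
- by have [-> _] := step N (leqnn N); rewrite mulfK // pnatr_eq0 -lt0n.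
- by have [_ ->] := step N (leqnn N); rewrite mulfK // pnatr_eq0 -lt0n.
Qed.

End Angles.

(** * Directions of lines *)

Section LineDirection.
Variable R : realType.
Implicit Types z w : R * R.

Definition normsq z : R := z.1 ^+ 2 + z.2 ^+ 2.
Definition dot z w : R := z.1 * w.1 + z.2 * w.2.

(** The unit vector z^2 / |z|^2 in complex notation.  Its angle is twice that of
z, so it depends only on the unoriented line spanned by z. *)
Definition line_cos z : R := (z.1 ^+ 2 - z.2 ^+ 2) / normsq z.
Definition line_sin z : R := (z.1 * z.2) *+ 2 / normsq z.

Lemma normsq_ge0 z : 0 <= normsq z.
Proof. by rewrite addr_ge0 ?sqr_ge0. Qed.

Lemma normsq_eq0 z : (normsq z == 0) = (z == 0).
Proof. by case: z => a b; rewrite /normsq paddr_eq0 ?sqr_ge0 // !sqrf_eq0. Qed.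

Lemma normsq_gt0 z : (0 < normsq z) = (z != 0).
Proof. by rewrite lt_def normsq_ge0 andbT normsq_eq0. Qed.

Lemma line_cos2Dsin2 z : z != 0 -> line_cos z ^+ 2 + line_sin z ^+ 2 = 1.
Proof.
rewrite -normsq_eq0 /line_cos /line_sin => nz; rewrite !expr_div_n -mulrDl.
apply/eqP; rewrite -[1](divff (expf_neq0 2 nz)); apply/eqP; congr (_ / _).
by rewrite /normsq mulr2n; ring.
Qed.

Lemma line_cosZ (k : R) z : k != 0 -> line_cos (k * z.1, k * z.2) = line_cos z.
Proof.
move=> k0; rewrite /line_cos /normsq /= !exprMn -mulrBr -mulrDr.
by rewrite -mulf_div divff ?expf_neq0 // mul1r.
Qed.

Lemma line_sinZ (k : R) z : k != 0 -> line_sin (k * z.1, k * z.2) = line_sin z.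
Proof.
move=> k0; rewrite /line_sin /normsq /= !exprMn -mulrDr.
have -> : (k * z.1 * (k * z.2)) *+ 2 = k ^+ 2 * ((z.1 * z.2) *+ 2) by rewrite !mulr2n; ring.
by rewrite -mulf_div divff ?expf_neq0 // mul1r.
Qed.

Lemma line_cosB z w : line_cos z * line_cos w + line_sin z * line_sin w =
  (dot w z ^+ 2 - det2 w z ^+ 2) / (normsq z * normsq w).
Proof.
rewrite /line_cos /line_sin !mulf_div -mulrDl; congr (_ / _).
by rewrite /dot /det2 !mulr2n; ring.
Qed.

Lemma line_sinB z w : line_sin z * line_cos w - line_cos z * line_sin w =
  (dot w z * det2 w z) *+ 2 / (normsq z * normsq w).
Proof.
rewrite /line_cos /line_sin !mulf_div -mulrBl; congr (_ / _).
by rewrite /dot /det2 !mulr2n; ring.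
Qed.

Section Continuity.
Variables (T : topologicalType) (z : T -> R * R) (t : T).
Hypothesis cz1 : {for t, continuous (fun s => (z s).1)}.
Hypothesis cz2 : {for t, continuous (fun s => (z s).2)}.

Lemma normsq_continuous : {for t, continuous (fun s => normsq (z s))}.
Proof. exact: (continuousD (continuousM cz1 cz1) (continuousM cz2 cz2)). Qed.

Lemma near_neq0 : z t != 0 -> \forall s \near t, z s != 0.
Proof.
move=> nz; have nt : 0 < normsq (z t) by rewrite normsq_gt0.
near=> s; rewrite -normsq_gt0; near: s; exact: (cvgr_gt _ normsq_continuous).
Unshelve. all: by end_near. Qed.

Lemma line_cos_continuous : z t != 0 -> {for t, continuous (fun s => line_cos (z s))}.
Proof.
rewrite -normsq_eq0 => nz; have cn := @continuousV _ _ (fun s => normsq (z s)) t nz normsq_continuous.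
exact: (continuousM (continuousB (continuousM cz1 cz1) (continuousM cz2 cz2)) cn).
Qed.

Lemma line_sin_continuous : z t != 0 -> {for t, continuous (fun s => line_sin (z s))}.
Proof.
rewrite -normsq_eq0 => nz; have cn := @continuousV _ _ (fun s => normsq (z s)) t nz normsq_continuous.
exact: (continuousM (continuousD (continuousM cz1 cz2) (continuousM cz1 cz2)) cn).
Qed.

End Continuity.

Lemma near_eq_continuous (T : topologicalType) (f g : T -> R) (t : T) :
  {for t, continuous f} -> (\forall s \near t, f s = g s) -> {for t, continuous g}.
Proof.
move=> cf fg; rewrite /prop_for /continuous_at -(nbhs_singleton fg).
by apply: cvg_trans cf; apply: near_eq_cvg; apply: filterS fg => s ->.
Qed.

End LineDirection.

(** * Chords and lines of sight *)

Section Slope.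
Variables (R : realType) (f : R -> R).
Hypothesis df : forall v, derivable f v 1.
Hypothesis cdf : continuous (derive1 f).

Definition slope (u v : R) : R :=
  if u == v then derive1 f u else (f v - f u) / (v - u).

Lemma slopeC u v : slope u v = slope v u.
Proof.
rewrite /slope eq_sym; case: eqVneq => [->//|_].
by rewrite -opprB -[v - u]opprB invrN mulrNN.
Qed.

Lemma slopeE u v : f v - f u = (v - u) * slope u v.
Proof.
rewrite /slope; case: eqVneq => [->|uv]; first by rewrite !subrr mul0r.
by rewrite mulrC divfK // subr_eq0 eq_sym.
Qed.

Lemma slope_mean u v : u <= v -> exists2 w, u <= w <= v & slope u v = derive1 f w.
Proof.
rewrite le_eqVlt => /orP[/eqP<-|uv].
  by exists u; rewrite ?lexx // /slope eqxx.
have [||w wuv E] := @MVT R f (derive1 f) u v uv.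
- by move=> x _; rewrite derive1E; exact: derivableP.
- by apply: derivable_within_continuous => x _.
exists w; first by move: wuv; rewrite in_itv /= => /andP[? ?]; rewrite !ltW.
by rewrite /slope lt_eqF // E mulfK // subr_eq0 gt_eqF.
Qed.

(** A difference quotient is a value of the derivative between the two points, so
it is jointly continuous on the diagonal when the derivative is continuous. *)
Lemma slope_continuous (t : R) :
  {for (t, t), continuous (fun uv : R * R => slope uv.1 uv.2)}.
Proof.
apply/cvgrPdist_lt => e e0 /=.
have : \forall w \near t, `|derive1 f t - derive1 f w| < e.
  have h := @cvgr_dist_lt _ _ _ _ _ _ _ (@cdf t) e e0. exact: h.
move=> /nbhs_ballP[d /= d0 hd].
near=> uv.
have u_t : `|t - uv.1| < d.
  near: uv; have h := @cvgr_dist_lt _ _ _ _ _ _ _ (@cvg_fst R R (nbhs t) (nbhs t) _) d d0; exact: h.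
have v_t : `|t - uv.2| < d.
  near: uv; have h := @cvgr_dist_lt _ _ _ _ _ _ _ (@cvg_snd R R (nbhs t) (nbhs t) _) d d0; exact: h.
rewrite /= [slope t t]/slope eqxx; move: uv.1 uv.2 u_t v_t => u v.
wlog luv : u v / u <= v.
  by move=> W; case: (leP u v) => [|/ltW vu] h1 h2; [|rewrite slopeC]; apply: W.
have [w wuv -> h1 h2] := slope_mean luv; apply: hd.
rewrite /ball /=; move: h1 h2 wuv; rewrite !ltr_norml => /andP[? ?] /andP[? ?] /andP[? ?].
by apply/andP; split; lra.
Unshelve. all: by end_near. Qed.

End Slope.

Section Sight.
Variables (R : realType) (ga : R -> R * R).

Definition velocity (v : R) : R * R :=
  (derive1 (fun v => (ga v).1) v, derive1 (fun v => (ga v).2) v).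

Definition regular_curve : Prop :=
  [/\ forall v, derivable (fun v => (ga v).1) v 1,
      forall v, derivable (fun v => (ga v).2) v 1,
      continuous (derive1 (fun v => (ga v).1)),
      continuous (derive1 (fun v => (ga v).2)) &
      forall v, velocity v <> (0, 0)].

Definition chord (u v : R) : R * R :=
  (slope (fun v => (ga v).1) u v, slope (fun v => (ga v).2) u v).

(** At a time when the curve passes through p, the tangent replaces the vanishing
vector; its line is the limit of the lines of sight. *)
Definition sight (p : R * R) (v : R) : R * R :=
  if ga v == p then velocity v else ga v - p.

Hypothesis reg : regular_curve.

Lemma regular_continuous1 : continuous (fun v => (ga v).1).
Proof. by case: reg => d _ _ _ _ v; apply/differentiable_continuous/derivable1_diffP. Qed.

Lemma regular_continuous2 : continuous (fun v => (ga v).2).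
Proof. by case: reg => _ d _ _ _ v; apply/differentiable_continuous/derivable1_diffP. Qed.

Lemma velocity_neq0 v : velocity v != 0.
Proof. by case: reg => _ _ _ _ /(_ v) h; apply/eqP. Qed.

Lemma sight_neq0 p v : sight p v != 0.
Proof. by rewrite /sight; case: (eqVneq (ga v) p) => h; [exact: velocity_neq0|rewrite subr_eq0]. Qed.

Lemma chordxx u : chord u u = velocity u.
Proof. by rewrite /chord /slope eqxx. Qed.

Lemma chordE u v : ga v - ga u = ((v - u) * (chord u v).1, (v - u) * (chord u v).2).
Proof. by rewrite /chord /= -!slopeE. Qed.

(** The chord is a multiple of the line of sight, and does not degenerate near the
diagonal. *)
Lemma line_sight_chord u v : chord u v != 0 ->
  line_cos (sight (ga u) v) = line_cos (chord u v) /\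
  line_sin (sight (ga u) v) = line_sin (chord u v).
Proof.
move=> c0; rewrite /sight; have := chordE u v.
case: (eqVneq v u) => [->|vu] E; first by rewrite eqxx chordxx.
have vu0 : v - u != 0 by rewrite subr_eq0.
case: eqVneq => [e|_]; last by rewrite E line_cosZ ?line_sinZ.
move: c0 E; rewrite e subrr => c0 [/esym/eqP + /esym/eqP].
rewrite !mulf_eq0 (negbTE vu0) /= => /eqP a /eqP b.
by move: c0; rewrite [chord u v]surjective_pairing /= a b eqxx.
Qed.

Section Chord.
Variables (T : topologicalType) (a b : T -> R) (t : T).
Hypotheses (ca : {for t, continuous a}) (cb : {for t, continuous b}) (ab : a t = b t).

Lemma slope_comp_continuous (f : R -> R) : (forall v, derivable f v 1) ->
  continuous (derive1 f) -> {for t, continuous (fun s => slope f (a s) (b s))}.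
Proof.
move=> df cf; have h := @slope_continuous _ _ df cf (b t).
have ca' : a s @[s --> t] --> b t by rewrite -ab; exact: ca.
have hs := continuous2_cvg (nbhs_filter t) (h : _ --> _) ca' cb.
by rewrite /prop_for /continuous_at ab; exact: hs.
Qed.

Lemma chord_continuous1 : {for t, continuous (fun s => (chord (a s) (b s)).1)}.
Proof. by case: reg => d1 _ c1 _ _; exact: (slope_comp_continuous d1 c1). Qed.

Lemma chord_continuous2 : {for t, continuous (fun s => (chord (a s) (b s)).2)}.
Proof. by case: reg => _ d2 _ c2 _; exact: (slope_comp_continuous d2 c2). Qed.

(** Viewed from a point of the curve, a nearby point of the same curve is seen in
a direction that depends continuously on both. *)
Lemma line_sight_diag :
  {for t, continuous (fun s => line_cos (sight (ga (a s)) (b s)))} /\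
  {for t, continuous (fun s => line_sin (sight (ga (a s)) (b s)))}.
Proof.
have cn : chord (a t) (b t) != 0 by rewrite ab chordxx velocity_neq0.
have near_c := near_neq0 chord_continuous1 chord_continuous2 cn.
split.
  apply: near_eq_continuous (line_cos_continuous chord_continuous1 chord_continuous2 cn) _.
  near=> s; have /line_sight_chord[] : chord (a s) (b s) != 0 by near: s.
  by move=> ->.
apply: near_eq_continuous (line_sin_continuous chord_continuous1 chord_continuous2 cn) _.
near=> s; have /line_sight_chord[] : chord (a s) (b s) != 0 by near: s.
by move=> _ ->.
Unshelve. all: by end_near. Qed.

End Chord.

End Sight.

(** * Total turning of the line of sight *)

Section Turning.
Variables (R : realType) (ga : R -> R * R).
Hypothesis reg : regular_curve ga.

Lemma line_sight_off (T : topologicalType) (p : T -> R * R) (b : T -> R) (t : T) :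
  {for t, continuous (fun s => (p s).1)} -> {for t, continuous (fun s => (p s).2)} ->
  {for t, continuous b} -> ga (b t) != p t ->
  {for t, continuous (fun s => line_cos (sight ga (p s) (b s)))} /\
  {for t, continuous (fun s => line_sin (sight ga (p s) (b s)))}.
Proof.
move=> cp1 cp2 cb ne; pose z s := ga (b s) - p s.
have cz1 : {for t, continuous (fun s => (z s).1)}.
  apply: (continuousB _ cp1).
  exact: (continuous_comp cb (@regular_continuous1 _ _ reg _)).
have cz2 : {for t, continuous (fun s => (z s).2)}.
  apply: (continuousB _ cp2).
  exact: (continuous_comp cb (@regular_continuous2 _ _ reg _)).
have z0 : z t != 0 by rewrite subr_eq0.
have near_z := near_neq0 cz1 cz2 z0.
have zE s : z s != 0 -> sight ga (p s) (b s) = z s.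
  by rewrite subr_eq0 /sight => /negbTE ->.
split.
  apply: near_eq_continuous (line_cos_continuous cz1 cz2 z0) _.
  by near=> s; rewrite zE //; near: s.
apply: near_eq_continuous (line_sin_continuous cz1 cz2 z0) _.
by near=> s; rewrite zE //; near: s.
Unshelve. all: by end_near. Qed.

Lemma line_sight_continuous p :
  continuous (fun v => line_cos (sight ga p v)) /\
  continuous (fun v => line_sin (sight ga p v)).
Proof.
suff loc v : {for v, continuous (fun v => line_cos (sight ga p v))} /\
             {for v, continuous (fun v => line_sin (sight ga p v))}.
  by split=> v; have [] := loc v.
have [<-|ne] := eqVneq (ga v) p.
  by apply: (line_sight_diag reg (a := cst v) (b := id)) => //; exact: cvg_cst.
exact: (line_sight_off (p := cst p) (b := id) (cvg_cst _) (cvg_cst _) cvg_id ne).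
Qed.

Definition direction_lift p (th : R -> R) :=
  lifts th (fun v => line_cos (sight ga p v)) (fun v => line_sin (sight ga p v)) 2.

(** Twice the angle by which the line from p to the moving point of the closed
curve turns in one period.  Lifts on [-2, 2] also cover periods starting at any
point of [-1, 1]. *)
Definition turning p : R :=
  let th := get [set th | direction_lift p th] in th 1 - th 0.

Hypothesis per : forall v, ga (v + 1) = ga v.

Lemma velocity_periodic v : velocity ga (v + 1) = velocity ga v.
Proof.
suff derP (f : R -> R) : (forall v, f (v + 1) = f v) -> derive1 f (v + 1) = derive1 f v.
  by congr pair; apply: derP => w; rewrite per.
move=> pf; rewrite /derive1 pf.
suff -> : (fun h : R => h^-1 *: (f (h + (v + 1)) - f v)) =
          (fun h : R => h^-1 *: (f (h + v) - f v)) by [].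
by apply/funext => h; rewrite addrA pf.
Qed.

Lemma sight_periodic p v : sight ga p (v + 1) = sight ga p v.
Proof. by rewrite /sight per velocity_periodic. Qed.

Lemma turningP p : exists2 th, direction_lift p th &
  forall b, -1 <= b <= 1 -> turning p = th (b + 1) - th b.
Proof.
have [cc cs] := line_sight_continuous p.
have ex : exists th, direction_lift p th.
  apply: lift_exists => // v; exact/line_cos2Dsin2/sight_neq0.
have := getPex ex; rewrite /turning; set th := get _ => /= thP.
exists th => // b /andP[b1 b2].
have N2 (v : R) : -1 <= v <= 1 -> `|v| <= 2 /\ `|v + 1| <= 2.
  by move=> /andP[? ?]; split; rewrite ler_norml; apply/andP; split; lra.
have const (v w : R) : -1 <= v -> v <= w -> w <= 1 -> th (v + 1) - th v = th (w + 1) - th w.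
  move=> v1 vw w1; apply: (@cos1_constant _ (fun x => th (x + 1) - th x)) => // x /andP[vx xw].
    have [|n1 n2] := N2 x; first by apply/andP; split; lra.
    have [c1 _ _] := thP _ n1; have [c2 _ _] := thP _ n2.
    have ca : {for x, continuous (fun x : R => x + 1)}.
      by apply: continuousD; [exact: cvg_id|exact: cvg_cst].
    exact: (continuousB (continuous_comp ca c2) c1).
  have [|n1 n2] := N2 x; first by apply/andP; split; lra.
  rewrite cosB; have [_ -> ->] := thP _ n1; have [_ -> ->] := thP _ n2.
  by rewrite sight_periodic -!expr2 line_cos2Dsin2 ?sight_neq0.
have -> : th 1 - th 0 = th (0 + 1) - th 0 by rewrite add0r.
by have [b0|/ltW b0] := lerP b 0; [apply/esym|]; apply: const.
Qed.

Lemma cos_turning p : cos (turning p) = 1.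
Proof.
have [th thP E] := turningP p.
rewrite (E 0) ?add0r; last by apply/andP; split; lra.
rewrite cosB; have [|_ -> ->] := thP 1; first by rewrite normr1; lra.
have [|_ -> ->] := thP 0; first by rewrite normr0; lra.
by have := sight_periodic p 0; rewrite add0r => ->; rewrite -!expr2 line_cos2Dsin2 ?sight_neq0.
Qed.

(** Turnings are multiples of 2 pi, so an error below 2 pi vanishes. *)
Lemma turning_eq p q (s : R) : cos s = 1 ->
  `|turning p - turning q - s| < pi *+ 2 -> turning p = turning q + s.
Proof.
move=> cs lt2; suff : turning p - turning q - s = 0 by lra.
apply: cos1_eq0 lt2; have sin0 (x : R) : cos x = 1 -> sin x = 0.
  by move=> h; apply: cos1sin0; rewrite h normr1.
have cp := cos_turning p; have cq := cos_turning q.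
by rewrite cosB sinB cosB cs cp cq !(sin0 _ cp, sin0 _ cq, sin0 _ cs); ring.
Qed.

Section Moving.
Variables (gb : R -> R * R) (t0 : R).
Hypothesis regb : regular_curve gb.

(** At such a parameter the line of sight from gb t to ga is continuous as t goes
through t0: either the points are apart, or both belong to one strand, gb being
ga up to a shift of the parameter. *)
Definition unobstructed (v : R) := ga v != gb t0 \/
  exists2 k, v = t0 + k & forall t, gb t = ga (t + k).

Lemma direction_near v : unobstructed v ->
  \forall v' \near v & t \near t0,
    1 / 2 < (line_cos (sight ga (gb t) v') * line_cos (sight ga (gb t0) v') +
             line_sin (sight ga (gb t) v') * line_sin (sight ga (gb t0) v')) ^+ 2.
Proof.
move=> un.
have c1 : {for (v, t0), continuous (fun w : R * R => w.1)} by exact: cvg_fst.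
have c2 : {for (v, t0), continuous (fun w : R * R => w.2)} by exact: cvg_snd.
have [cc cs] : {for (v, t0), continuous (fun w : R * R => line_cos (sight ga (gb w.2) w.1))}
  /\ {for (v, t0), continuous (fun w : R * R => line_sin (sight ga (gb w.2) w.1))}.
  case: un => [ne|[k vk gbE]].
    have p1 := continuous_comp c2 (@regular_continuous1 _ _ regb t0).
    have p2 := continuous_comp c2 (@regular_continuous2 _ _ regb t0).
    exact: (line_sight_off p1 p2 c1 ne).
  have -> : gb = fun t => ga (t + k) by apply/funext.
  apply: (line_sight_diag reg (a := fun w : R * R => w.2 + k)) => //=.
  by apply: continuousD => //; exact: cvg_cst.
have [cc0 cs0] := line_sight_continuous (gb t0).
have cf : {for (v, t0), continuous (fun w : R * R =>
   line_cos (sight ga (gb w.2) w.1) * line_cos (sight ga (gb t0) w.1) +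
   line_sin (sight ga (gb w.2) w.1) * line_sin (sight ga (gb t0) w.1))}.
  exact: (continuousD (continuousM cc (continuous_comp c1 (cc0 _)))
                      (continuousM cs (continuous_comp c1 (cs0 _)))).
have := continuousM cf cf => cff.
apply: filterS (cvgr_gt _ cff (1/2) _) => [[v' t]|] /=; first by rewrite expr2.
by rewrite -!expr2 line_cos2Dsin2 ?sight_neq0 // expr1n; lra.
Qed.

Lemma lift_dist_near a b : (forall v, a <= v <= b -> unobstructed v) ->
  a <= b -> -2 <= a -> b <= 2 ->
  exists2 e, 0 < e & forall t, `|t - t0| < e -> forall th th0,
    direction_lift (gb t) th -> direction_lift (gb t0) th0 ->
    `|(th b - th0 b) - (th a - th0 a)| < pi / 2.
Proof.
move=> un ab a2 b2.
have [v vab|e e0 he] := segment_uniformly (a := a) (b := b) (t0 := t0) (P := fun t v =>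
  1 / 2 < (line_cos (sight ga (gb t) v) * line_cos (sight ga (gb t0) v) +
           line_sin (sight ga (gb t) v) * line_sin (sight ga (gb t0) v)) ^+ 2).
  exact/direction_near/un.
exists e => // t te th th0 l l0; apply: lift_dist l l0 _ => // v; exact: he.
Qed.

Lemma turning_stable : (forall v, unobstructed v) ->
  \forall t \near t0, turning (gb t) = turning (gb t0).
Proof.
move=> un; have [|||e e0 he] := @lift_dist_near 0 1 (fun v _ => un v); try lra.
apply/nbhs_ballP; exists e => //= t; rewrite /ball /= distrC => te.
have [th thP E] := turningP (gb t); have [th0 th0P E0] := turningP (gb t0).
have := he t te _ _ thP th0P; have p0 := @pi_gt0 R.
rewrite -[turning (gb t0)]addr0 => lt; apply: turning_eq; first exact: cos0.
have i0 : -1 <= (0 : R) <= 1 by apply/andP; split; lra.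
rewrite (E 0) // (E0 0) // add0r subr0 mulr2n.
move: lt; set x := _ - _ - _; set y := _ - _ - _; have -> : y = x by rewrite /x /y; ring.
move=> ?; lra.
Qed.

End Moving.

End Turning.

(** * The jump at a transversal crossing *)

Section Jump.
Variables (R : realType) (ga gb : R -> R * R) (v0 t0 : R).
Hypotheses (rega : regular_curve ga) (regb : regular_curve gb).
Hypothesis meet : ga v0 = gb t0.
Let T := velocity ga v0.

(** The bound 1/4 could be any small constant: it makes the chords from the
crossing point close enough to the tangent for lift_dist and lift_jump. *)
Lemma chord_window : exists2 e, 0 < e & forall v, `|v - v0| < e ->
  0 < dot (chord ga v0 v) T /\
  `|det2 T (chord ga v0 v)| < dot T (chord ga v0 v) / 4.
Proof.
have cv0 : {for v0, continuous (cst v0 : R -> R)} by exact: cvg_cst.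
have cid : {for v0, continuous (id : R -> R)} by exact: cvg_id.
have c1 := chord_continuous1 rega cv0 cid erefl.
have c2 := chord_continuous2 rega cv0 cid erefl.
have cc (a : R) : {for v0, continuous (cst a : R -> R)} by exact: cvg_cst.
have cdot : {for v0, continuous (fun v => dot T (chord ga v0 v))}.
  exact: (continuousD (continuousM (cc _) c1) (continuousM (cc _) c2)).
have cdet : {for v0, continuous (fun v => det2 T (chord ga v0 v))}.
  exact: (continuousB (continuousM (cc _) c2) (continuousM (cc _) c1)).
have dot_gt : 0 < dot T (chord ga v0 v0).
  rewrite chordxx -/T /dot -!expr2; have := velocity_neq0 rega v0.
  by rewrite -normsq_gt0.
have det_eq : det2 T (chord ga v0 v0) = 0.
  by rewrite chordxx -/T /det2 mulrC subrr.
have : \forall v \near v0, 0 < dot T (chord ga v0 v) / 4 - det2 T (chord ga v0 v) /\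
                        0 < dot T (chord ga v0 v) / 4 + det2 T (chord ga v0 v).
  have h1 : 0 < dot T (chord ga v0 v0) / 4 - det2 T (chord ga v0 v0) by rewrite det_eq; lra.
  have h2 : 0 < dot T (chord ga v0 v0) / 4 + det2 T (chord ga v0 v0) by rewrite det_eq; lra.
  have k1 := cvgr_gt _ (continuousB (continuousM cdot (cc _)) cdet) _ h1.
  have k2 := cvgr_gt _ (continuousD (continuousM cdot (cc _)) cdet) _ h2.
  by near=> v; split; near: v; [exact: k1|exact: k2].
move=> /nbhs_ballP[e /= e0 he]; exists e => // v; rewrite distrC => /he[h1 h2].
have dotC : dot (chord ga v0 v) T = dot T (chord ga v0 v).
  by rewrite /dot mulrC [X in _ + X]mulrC.
by rewrite dotC ltr_norml; split; [lra|apply/andP; split; lra].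
Unshelve. all: by end_near. Qed.

Hypothesis transversal : det2 (velocity gb t0) T != 0.

Lemma chord_transversal : exists2 e, 0 < e & forall v t, `|v - v0| < e -> `|t - t0| < e ->
  0 < det2 (chord gb t0 t) (chord ga v0 v) * det2 (velocity gb t0) T.
Proof.
have c1 : {for (v0, t0), continuous (fun w : R * R => w.1)} by exact: cvg_fst.
have c2 : {for (v0, t0), continuous (fun w : R * R => w.2)} by exact: cvg_snd.
have cc (a : R) : {for (v0, t0), continuous (cst a : R * R -> R)} by exact: cvg_cst.
have a1 := chord_continuous1 rega (cc v0) c1 erefl.
have a2 := chord_continuous2 rega (cc v0) c1 erefl.
have b1 := chord_continuous1 regb (cc t0) c2 erefl.
have b2 := chord_continuous2 regb (cc t0) c2 erefl.
have cd : {for (v0, t0), continuous (fun w : R * R =>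
    det2 (chord gb t0 w.2) (chord ga v0 w.1) * det2 (velocity gb t0) T)}.
  exact: (continuousM (continuousB (continuousM b1 a2) (continuousM b2 a1)) (cc _)).
have : \forall w \near (v0, t0),
    0 < det2 (chord gb t0 w.2) (chord ga v0 w.1) * det2 (velocity gb t0) T.
  apply: (cvgr_gt _ cd); rewrite /= !chordxx -/T -expr2.
  by rewrite lt_def sqrf_eq0 transversal sqr_ge0.
move=> /nbhs_ballP[e /= e0 he]; exists e => // v t ve te.
by apply: (he (v, t)); split; rewrite /ball /= distrC.
Qed.

(* Coordinates of the line of sight in the frame of the velocity T, up to the
   factor given by the length of T: it points to the left of T iff eta > 0. *)
Let xi t v := dot T (ga v - gb t).
Let eta t v := det2 T (ga v - gb t).

Lemma frame_normsq t v : xi t v ^+ 2 + eta t v ^+ 2 = normsq (ga v - gb t) * normsq T.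
Proof. by rewrite /xi /eta /dot /det2 /normsq /=; ring. Qed.

(** When the point gb t has left the crossing, the part of ga that is abreast of
it, in the direction normal to T, lies on a side that is determined by the
direction of the motion and the sign of the crossing. *)
Lemma frame_offset t v (s : R) : s = Num.sg (t - t0) * - Num.sg (det2 (velocity gb t0) T) ->
  0 < dot (chord ga v0 v) T ->
  0 < det2 (chord gb t0 t) (chord ga v0 v) * det2 (velocity gb t0) T ->
  t != t0 -> xi t v = 0 -> s * eta t v < 0.
Proof.
move=> -> dot_gt det_gt tt0 x0.
have N0 : 0 < normsq T by rewrite normsq_gt0; exact: velocity_neq0.
set q := chord ga v0 v in dot_gt det_gt *; set r := chord gb t0 t in det_gt *.
have zE : ga v - gb t = ((v - v0) * q.1 - (t - t0) * r.1, (v - v0) * q.2 - (t - t0) * r.2).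
  have := chordE ga v0 v; have := chordE gb t0 t; rewrite -/q -/r -meet => h1 h2.
  have -> : ga v - gb t = (ga v - ga v0) - (gb t - ga v0) by rewrite opprB addrA subrK.
  by rewrite h1 h2.
(* Taking det2 q of the equation zE removes the term in q; the frame coordinates
   of the line of sight reduce to eta because xi vanishes. *)
have key : eta t v * dot q T = (t - t0) * det2 r q * normsq T.
  transitivity (det2 q (ga v - gb t) * normsq T - xi t v * det2 q T).
    by rewrite /eta /xi /dot /det2 /normsq; ring.
  by rewrite x0 mul0r subr0 zE /det2 /=; ring.
set a := det2 r q in key det_gt; set b := det2 _ T in det_gt *.
set y := eta t v in key *; set d := dot q T in key dot_gt; set N := normsq T in key N0.
have b_gt : 0 < Num.sg b * a.
  have b0 : b != 0 by apply: contraTneq det_gt => ->; rewrite mulr0 ltxx.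
  have nb : 0 < `|b| by rewrite normr_gt0.
  by rewrite -(pmulr_lgt0 _ nb) mulrAC -numEsg mulrC.
have t_gt : 0 < Num.sg (t - t0) * (t - t0).
  by rewrite -normrEsg normr_gt0 subr_eq0.
rewrite -(pmulr_llt0 _ dot_gt) -mulrA key.
have -> : Num.sg (t - t0) * - Num.sg b * ((t - t0) * a * N) =
  - (Num.sg (t - t0) * (t - t0) * (Num.sg b * a) * N) by ring.
by rewrite oppr_lt0; apply: mulr_gt0 => //; exact: mulr_gt0.
Qed.

Hypothesis per : forall v, ga (v + 1) = ga v.
Hypothesis v0_itv : 0 <= v0 <= 1.
Hypothesis un : forall v, (forall k : int, v <> v0 + k%:~R) -> unobstructed ga gb t0 v.

(** The period is cut at v0 - e and v0 + e.  Outside the window around v0 the two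
lines of sight, from gb t and from gb t0, are close to each other.  Inside it,
the one from gb t0 stays close to the tangent, and the one from gb t makes a
half turn, as in lift_jump.  The errors are below pi / 2, pi / 2 and pi. *)
Lemma turning_jump : \forall t \near t0, t != t0 ->
  turning ga (gb t) = turning ga (gb t0) -
    Num.sg (t - t0) * Num.sg (det2 (velocity gb t0) T) * (pi *+ 2).
Proof.
have [e1 e1_gt0 win] := chord_window; have [e2 e2_gt0 trans] := chord_transversal.
pose e := Num.min (1 / 4) (Num.min (e1 / 2) (e2 / 2)).
have e0 : 0 < e by rewrite !lt_min; apply/and3P; split; lra.
have e_4 : e <= 1 / 4 by rewrite /e ge_min lexx.
have e_1 : e < e1.
  have : e <= e1 / 2 by rewrite /e !ge_min lexx !orbT.
  lra.
have e_2 : e < e2.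
  have : e <= e2 / 2 by rewrite /e !ge_min lexx !orbT.
  lra.
have /andP[v00 v01] := v0_itv.
pose u := v0 - e; pose w := v0 + e.
have in_win v : u <= v <= w -> `|v - v0| <= e.
  by rewrite /u /w ler_norml => /andP[? ?]; apply/andP; split; lra.
have un_out v : w <= v <= u + 1 -> unobstructed ga gb t0 v.
  move=> /andP[wv vu]; apply: un => k vk; rewrite /w /u vk in wv vu.
  have k0 : 0 < k by rewrite -(ltr0z R); lra.
  have k1 : k < 1 by rewrite -(ltrz1 R); lra.
  by move: k0 k1; case: k {vk wv vu} => [[]|].
have wu1 : w <= u + 1 by rewrite /w /u; lra.
have [||d d0 far] := lift_dist_near rega regb un_out wu1; try (rewrite /w /u; lra).
have cb1 := regular_continuous1 regb; have cb2 := regular_continuous2 regb.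
have xi_cont v : {for t0, continuous (fun t => xi t v)}.
  exact: (continuousD (continuousM (cvg_cst _) (continuousB (cvg_cst _) (@cb1 t0)))
                      (continuousM (cvg_cst _) (continuousB (cvg_cst _) (@cb2 t0)))).
have eta_cont v : {for t0, continuous (fun t => eta t v)}.
  exact: (continuousB (continuousM (cvg_cst _) (continuousB (cvg_cst _) (@cb2 t0)))
                      (continuousM (cvg_cst _) (continuousB (cvg_cst _) (@cb1 t0)))).
have xi0 v : `|v - v0| < e1 -> v != v0 -> `|eta t0 v| < Num.sg (v - v0) * xi t0 v / 4.
  move=> /win[_]; rewrite -subr_eq0 => lt nz.
  have -> : eta t0 v = (v - v0) * det2 T (chord ga v0 v).
    by rewrite /eta -meet chordE /det2 /=; ring.
  have -> : xi t0 v = (v - v0) * dot T (chord ga v0 v).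
    by rewrite /xi -meet chordE /dot /=; ring.
  by rewrite mulrA -normrEsg normrM -mulrA ltr_pM2l // normr_gt0.
have ends : \forall t \near t0, `|eta t u| < - xi t u /\ `|eta t w| < xi t w.
  have := xi0 u; rewrite /u addrAC subrr add0r normrN gtr0_norm // => /(_ e_1).
  rewrite ltr0_sg ?oppr_lt0 // mulN1r -/u => hu.
  have := xi0 w; rewrite /w addrAC subrr add0r gtr0_norm // => /(_ e_1).
  rewrite gtr0_sg // mul1r -/w => hw.
  have {}hu := hu _; have {}hw := hw _.
  have lu : 0 < - xi t0 u - `|eta t0 u|.
    by have := normr_ge0 (eta t0 u); have /hu : u != v0; rewrite /u; [rewrite -subr_eq0; lra|lra].
  have lw : 0 < xi t0 w - `|eta t0 w|.
    by have := normr_ge0 (eta t0 w); have /hw : w != v0; rewrite /w; [rewrite -subr_eq0; lra|lra].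
  have k1 := cvgr_gt _ (continuousB (continuousN (xi_cont u)) (cvg_norm (eta_cont u))) _ lu.
  have k2 := cvgr_gt _ (continuousB (xi_cont w) (cvg_norm (eta_cont w))) _ lw.
  near=> t; split; rewrite -subr_gt0; near: t; [exact: k1|exact: k2].
have near_t : \forall t \near t0, `|t - t0| < Num.min d e2.
  apply/nbhs_ballP; exists (Num.min d e2) => [|t] /=; first by rewrite lt_min d0.
  by rewrite /ball /= distrC.
near=> t; move=> tt0.
have [eu ew] : `|eta t u| < - xi t u /\ `|eta t w| < xi t w by near: t.
have : `|t - t0| < Num.min d e2 by near: t.
rewrite lt_min => /andP[td te2].
have [th thP E] := turningP rega per (gb t).
have [th0 th0P E0] := turningP rega per (gb t0).
have [phi phiP] : exists phi, cos phi = line_cos T /\ sin phi = line_sin T.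
  have [|||ph phP] := @lift_exists _ (cst (line_cos T)) (cst (line_sin T)) 0.
  - exact: cst_continuous.
  - exact: cst_continuous.
  - by move=> v; exact: (line_cos2Dsin2 (velocity_neq0 rega v0)).
  - by exists (ph 0); have [|_ -> ->] := phP 0; rewrite ?normr0.
(* The sense of the half turn.  If it is clockwise, lift_jump is applied to the
   mirror image, obtained by negating eta and the angle. *)
pose s := Num.sg (t - t0) * - Num.sg (det2 (velocity gb t0) T).
have s2 : s ^+ 2 = 1.
  by rewrite /s exprMn sqrrN !sqr_sg transversal subr_eq0 tt0 mul1r.
have s1 : `|s| = 1 by apply/eqP; rewrite -sqr_norm_eq1 s2.
have off v : u <= v <= w -> xi t v = 0 -> s * eta t v < 0.
  move=> /in_win vw; apply: (frame_offset erefl) => //.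
    by have [] := win v (le_lt_trans vw e_1).
  exact: trans (le_lt_trans vw e_2) te2.
have w2 : w <= 2 by rewrite /w; lra.
have u2 : - 2 <= u by rewrite /u; lra.
have uw : u <= w by rewrite /u /w; lra.
have z0 v : u <= v <= w -> ga v != gb t.
  move=> vuw; apply: contraTneq isT => zz; have := off v vuw.
  by rewrite /xi /eta zz subrr /dot /det2 !mulr0 addr0 subr0 mulr0 ltxx => /(_ erefl).
have sightE v : u <= v <= w -> sight ga (gb t) v = ga v - gb t.
  by move=> /z0; rewrite /sight => /negbTE ->.
have nz v : u <= v <= w -> normsq (ga v - gb t) * normsq T != 0.
  move=> /z0 h; apply: mulf_neq0; rewrite normsq_eq0 ?subr_eq0 //.
  exact: velocity_neq0.
have cx : continuous (fun v => xi t v).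
  move=> v; exact: (continuousD
    (continuousM (cvg_cst _) (continuousB (@regular_continuous1 _ _ rega v) (cvg_cst _)))
    (continuousM (cvg_cst _) (continuousB (@regular_continuous2 _ _ rega v) (cvg_cst _)))).
have cy : continuous (fun v => s * eta t v).
  move=> v; apply: (continuousM (cvg_cst _)); exact: (continuousB
    (continuousM (cvg_cst _) (continuousB (@regular_continuous2 _ _ rega v) (cvg_cst _)))
    (continuousM (cvg_cst _) (continuousB (@regular_continuous1 _ _ rega v) (cvg_cst _)))).
have sE : s = 1 \/ s = -1 by apply/pred2P; rewrite -sqrf_eq1 s2.
pose C v := line_cos (sight ga (gb t) v); pose S v := line_sin (sight ga (gb t) v).
have lift_s : lifts (fun v => s * (th v - phi)) (fun v => C v * line_cos T + S v * line_sin T)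
    (fun v => s * (S v * line_cos T - C v * line_sin T)) 2.
  move=> v v2; have [cth cthE sthE] := thP v v2; have [<- <-] := phiP; split.
  - exact: (continuousM (cvg_cst _) (continuousB cth (cvg_cst _))).
  - by case: sE => ->; rewrite ?mul1r ?mulN1r ?cosN cosB cthE sthE.
  - by case: sE => ->; rewrite ?mul1r ?mulN1r ?sinN sinB cthE sthE.
have jump : `|th w - th u - s * (pi *+ 2)| < pi.
  have := lift_jump uw u2 w2 lift_s cx cy off => /(_ _ _ _ _)/wrap[].
  - move=> v vuw; rewrite exprMn s2 mul1r frame_normsq /C /S sightE //.
    by rewrite line_cosB divfK ?nz.
  - move=> v vuw; rewrite exprMn s2 mul1r frame_normsq /C /S sightE //.
    by rewrite line_sinB -mulrA divfK ?nz // mulrnAr mulrCA.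
  - by rewrite normrM s1 mul1r.
  - by rewrite normrM s1 mul1r.
  have -> : s * (th w - phi) - s * (th u - phi) - pi *+ 2 = s * (th w - th u - s * (pi *+ 2)).
    rewrite -[pi *+ 2 in LHS]mul1r -s2; ring.
  by rewrite normrM s1 mul1r.
have still : `|th0 w - th0 u| < pi / 2.
  have phi_lift : lifts (cst phi) (cst (line_cos T)) (cst (line_sin T)) 2.
    by move=> v _; have [? ?] := phiP; split=> //; exact: cvg_cst.
  have close v : u <= v <= w -> 1 / 2 < (line_cos (sight ga (gb t0) v) * line_cos T +
      line_sin (sight ga (gb t0) v) * line_sin T) ^+ 2.
    move=> /in_win vw; have [dot_gt det_lt] := win v (le_lt_trans vw e_1).
    have c0 : chord ga v0 v != 0.
      by apply: contraTneq dot_gt => ->; rewrite /dot !mul0r addr0 ltxx.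
    rewrite -meet; have [-> ->] := line_sight_chord c0.
    rewrite line_cosB; set D := dot _ _ in det_lt *; set K := det2 _ _ in det_lt *.
    have -> : normsq (chord ga v0 v) * normsq T = D ^+ 2 + K ^+ 2.
      by rewrite /D /K /normsq /dot /det2; ring.
    have D0 : 0 < D by have := normr_ge0 K; lra.
    have K2 : K ^+ 2 < D ^+ 2 / 16.
      have : `|K| ^+ 2 < (D / 4) ^+ 2 by rewrite ltrXn2r.
      rewrite real_normK ?num_real // => h; rewrite (_ : D ^+ 2 / 16 = (D / 4) ^+ 2) //.
      by field.
    have K0 := sqr_ge0 K; have D2 : 0 < D ^+ 2 by rewrite exprn_gt0.
    have r_gt : 3 / 4 < (D ^+ 2 - K ^+ 2) / (D ^+ 2 + K ^+ 2).
      by move: (D ^+ 2) (K ^+ 2) K2 K0 D2 => x y *; rewrite ltr_pdivlMr; lra.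
    move: r_gt; move: (_ / (D ^+ 2 + K ^+ 2)) => r r_gt.
    have : 0 < (r - 3 / 4) * (r + 3 / 4) by apply: mulr_gt0; lra.
    by rewrite -subr_sqr expr_div_n; lra.
  have := lift_dist uw u2 w2 th0P phi_lift close.
  by have -> : th0 w - cst phi w - (th0 u - cst phi u) = th0 w - th0 u by rewrite /=; ring.
have outer := far t td th th0 thP th0P.
have -> : turning ga (gb t0) - Num.sg (t - t0) * Num.sg (det2 (velocity gb t0) T) * (pi *+ 2)
  = turning ga (gb t0) + s * (pi *+ 2) by rewrite /s; ring.
apply: turning_eq => //.
  have : s == 1 \/ s == -1 by apply/orP; rewrite -sqrf_eq1 s2.
  by case=> /eqP ->; rewrite ?mul1r ?mulN1r ?cosN cos2pi.
have iu : -1 <= u <= 1 by apply/andP; split; rewrite /u; lra.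
rewrite (E u) // (E0 u) //; move: outer jump still.
rewrite !ltr_norml => /andP[? ?] /andP[? ?] /andP[? ?]; apply/andP; split; lra.
Unshelve. all: by end_near. Qed.

End Jump.

(** * Step functions *)

Section StepFunction.
Variable R : realType.
Implicit Types x y : R.

Lemma locally_constant (f : R -> R) x y :
  (forall t0, \forall t \near t0, f t = f t0) -> f x = f y.
Proof.
move=> loc; apply: is_derive_0_is_cst => t0.
apply: (@near_eq_is_derive _ _ _ (cst (f t0))) => //.
by apply: filterS (loc t0) => t ->.
Qed.

(** A step of 2 at every integer, split evenly between arrival and departure:
the value at an integer is the mean of the neighbouring values. *)
Definition step x : int := Num.ceil x + Num.floor x.

Lemma step_near x0 : \forall x \near x0,
  (step x)%:~R = (step x0)%:~R + (x0 \is a Num.int)%:R * Num.sg (x - x0) :> R.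
Proof.
have := ceil_itv x0; have := floor_itv x0; have := ceil_floor x0.
set c := Num.ceil x0; set f := Num.floor x0 => cf /andP[f1 f2] /andP[c1 c2].
pose e := Num.min (x0 - (c - 1)%:~R) ((f + 1)%:~R - x0).
have e0 : 0 < e by rewrite lt_min !subr_gt0 c1 f2.
apply/nbhs_ballP; exists e => // x; rewrite /ball /= lt_min ltr_norml ltr_norml.
move=> /andP[/andP[_ x1] /andP[x2 _]].
have {}x1 : (c - 1)%:~R < x by lra.
have {}x2 : x < (f + 1)%:~R by lra.
rewrite /step -/c -/f; have [int0|nint0] := boolP (x0 \is a Num.int); last first.
  rewrite cf nint0 in x1 *; rewrite addrK in x1.
  have -> : Num.ceil x = f + 1 by apply: ceil_def; rewrite addrK x1 ltW.
  have -> : Num.floor x = f by apply: floor_def; rewrite ltW.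
  by rewrite mul0r addr0.
have cE : c%:~R = x0 by apply/eqP; rewrite -intrEceil.
rewrite cf int0 addr0 in cE x1 *; rewrite mul1r.
have [xx0|xx0|->] := ltgtP x x0; last first.
- by rewrite subrr sgr0 addr0 -/c -/f cf int0 addr0.
- have -> : Num.ceil x = f + 1 by apply: ceil_def; rewrite addrK cE xx0 ltW.
  have -> : Num.floor x = f by apply: floor_def; rewrite cE ltW.
  by rewrite gtr0_sg ?subr_gt0 // !rmorphD /=; ring.
- have -> : Num.ceil x = f by apply: ceil_def; rewrite x1 cE ltW.
  have -> : Num.floor x = f - 1 by apply: floor_def; rewrite subrK cE xx0 ltW.
  by rewrite ltr0_sg ?subr_lt0 // !rmorphD rmorphN /=; ring.
Qed.

Lemma ceil_diff x y : x < y -> y <= x + 1 ->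
  Num.ceil y - Num.ceil x = (`[< exists k : int, x <= k%:~R < y >] : nat)%:Z.
Proof.
move=> xy yx; have /andP[c1 c2] := ceil_itv x; set m := Num.ceil x in c1 c2 *.
have [my|ym] := ltP m%:~R y.
  rewrite asboolT; last by exists m; rewrite c2.
  have -> : Num.ceil y = m + 1.
    apply: ceil_def; rewrite addrK my rmorphD /=; rewrite rmorphB /= in c1; lra.
  by rewrite addrAC subrr add0r.
rewrite asboolF.
  have -> : Num.ceil y = m by apply: ceil_def; rewrite ym andbT (lt_trans c1).
  by rewrite subrr.
move=> [k /andP[xk ky]]; have mk : (m <= k)%R by rewrite ceil_le_int.
by rewrite -(ler_int R) in mk; lra.
Qed.

Lemma floor_diff x y : x < y -> y <= x + 1 ->
  Num.floor y - Num.floor x = (`[< exists k : int, x < k%:~R <= y >] : nat)%:Z.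
Proof.
move=> xy yx; have := @ceil_diff (- y) (- x) _ _.
rewrite ltrN2 => /(_ xy) /(_ _)/wrap[]; first by lra.
rewrite !floorNceil opprK addrC => ->; congr (Posz (nat_of_bool _)).
by apply/asbool_equiv_eq; split=> -[k /andP[k1 k2]]; exists (- k);
  rewrite rmorphN /=; apply/andP; split; lra.
Qed.

End StepFunction.

(** * The mean winding number of a diagram *)

Section WindingNumber.
Variables (R : realType) (D : virtual_link_diagram R).

Local Notation tan := (tangent (@curve R D)).
Local Notation pt := (image_pt (@curve R D)).
Local Notation spair := (strand_pair (@curve R D)).

Let gen := curve_generic D.

Lemma curve_regular (i : 'I_(ncomp D)) : regular_curve (curve i).
Proof.
have [sm1 sm2] := curve_smooth gen i; split.
- exact: (sm1 0).
- exact: (sm2 0).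
- by move=> v; apply/differentiable_continuous/derivable1_diffP; exact: (sm1 1).
- by move=> v; apply/differentiable_continuous/derivable1_diffP; exact: (sm2 1).
- by move=> v; exact: (curve_immersion gen (P := (i, v))).
Qed.

Definition circle_pt (i : 'I_(ncomp D)) (t : R) : 'I_(ncomp D) * R :=
  (i, t - (Num.floor t)%:~R).

Lemma circle_ptE i t P : circle_point P ->
  (P.1 = i /\ exists k : int, P.2 + k%:~R = t) <-> P = circle_pt i t.
Proof. exact: fracP. Qed.

Lemma tangent_circle_pt i t : tan (circle_pt i t) = velocity (curve i) t.
Proof.
have per := curve_periodic gen i.
have nat_per v (k : nat) : velocity (curve i) (v + k%:R) = velocity (curve i) v.
  elim: k => [|k IH]; first by rewrite addr0.
  by rewrite -natr1 addrA velocity_periodic.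
have int_per v (k : int) : velocity (curve i) (v - k%:~R) = velocity (curve i) v.
  case: k => k; first by rewrite -[in RHS](subrK (Posz k)%:~R v) nat_per.
  by rewrite NegzE rmorphN opprK nat_per.
exact: int_per.
Qed.

Lemma pt_circle_pt i t : pt (circle_pt i t) = curve i t.
Proof. exact: pt_frac. Qed.

Lemma strand_pair_of_meet i t j v : curve j v = curve i t -> circle_pt j v <> circle_pt i t ->
  spair (circle_pt i t) (circle_pt j v).
Proof.
move=> E ne; split; [exact: frac_circle|exact: frac_circle|by move=> /esym|].
by rewrite !pt_circle_pt.
Qed.

Lemma same_strand_unobstructed i t0 j v : circle_pt j v = circle_pt i t0 ->
  unobstructed (curve j) (curve i) t0 v.
Proof.
case=> -> E; right; exists (v - t0); first by rewrite addrC subrK.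
move=> t; have -> : v - t0 = (Num.floor v - Num.floor t0)%:~R by rewrite rmorphB /=; lra.
by rewrite curve_int.
Qed.

(** Off the diagram this is the sum of the winding numbers of the components; the
turning counts doubled angles, hence 4 pi. *)
Definition mean_winding (p : R * R) : R := (\sum_j turning (@curve R D j) p) / (pi *+ 4).

(** If the point of the diagram is not a crossing, the only strand through it is
the one that is followed. *)
Lemma mean_winding_stable i t0 : (forall Q, ~ spair (circle_pt i t0) Q) ->
  \forall t \near t0, mean_winding (curve i t) = mean_winding (curve i t0).
Proof.
move=> none.
have loc (j : 'I_(ncomp D)) : \forall t \near t0,
    turning (curve j) (curve i t) = turning (curve j) (curve i t0).
  apply: (turning_stable (curve_regular j) (curve_periodic gen j) (curve_regular i)) => v.
   have [same|diff] := pselect (circle_pt j v = circle_pt i t0).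
    exact: same_strand_unobstructed.
  by left; apply/eqP => E; apply: (none _ (strand_pair_of_meet E diff)).
have all_j : \forall t \near t0, forall j : 'I_(ncomp D),
    turning (curve j) (curve i t) = turning (curve j) (curve i t0).
  exact: (@filter_forall _ _ (fun (j : 'I_(ncomp D)) t =>
    turning (curve j) (curve i t) = turning (curve j) (curve i t0)) (nbhs t0) (nbhs_filter _) loc).
near=> t; rewrite /mean_winding; congr (_ / _); apply: eq_bigr => j _.
by move: j; near: t.
Unshelve. all: by end_near. Qed.

(** There is no triple point, so Q is the only obstructing strand.  The jump of
2 pi in the turning of its component is divided by 4 pi. *)
Lemma mean_winding_jump i t0 Q : spair (circle_pt i t0) Q ->
  \forall t \near t0, t != t0 -> mean_winding (curve i t) = mean_winding (curve i t0) -
    Num.sg (t - t0) * Num.sg (det2 (tan (circle_pt i t0)) (tan Q)) / 2.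
Proof.
move=> PQ; have [_ cQ _ meet] := PQ; rewrite pt_circle_pt in meet.
have hit j v : curve j v = curve i t0 -> circle_pt j v <> circle_pt i t0 -> circle_pt j v = Q.
  by move=> E ne; apply: (no_triple_point gen (strand_pair_of_meet E ne) PQ).
have others (j : 'I_(ncomp D)) : j != Q.1 -> \forall t \near t0,
    turning (curve j) (curve i t) = turning (curve j) (curve i t0).
  move=> jQ; apply: (turning_stable (curve_regular j) (curve_periodic gen j) (curve_regular i)) => v.
   have [same|diff] := pselect (circle_pt j v = circle_pt i t0).
    exact: same_strand_unobstructed.
  by left; apply/eqP => E; move: jQ; rewrite -(hit j v E diff) eqxx.
have this : \forall t \near t0, t != t0 -> turning (curve Q.1) (curve i t) =
    turning (curve Q.1) (curve i t0) -
    Num.sg (t - t0) * Num.sg (det2 (tan (circle_pt i t0)) (tan Q)) * (pi *+ 2).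
  rewrite tangent_circle_pt.
  apply: (turning_jump (v0 := Q.2) (curve_regular Q.1) (curve_regular i) _ _
    (curve_periodic gen Q.1)).
  - by rewrite meet.
  - by rewrite -tangent_circle_pt; exact: (double_point_transversal gen PQ).
  - by move: cQ => /andP[-> /ltW ->].
  - move=> v vQ; have [same|diff] := pselect (circle_pt Q.1 v = circle_pt i t0).
      exact: same_strand_unobstructed.
    left; apply/eqP => E; apply: (vQ (Num.floor v)).
    by rewrite -(hit _ v E diff) /= subrK.
have all_j : \forall t \near t0, forall j : 'I_(ncomp D), j != Q.1 ->
    turning (curve j) (curve i t) = turning (curve j) (curve i t0).
  apply: (@filter_forall _ _ (fun (j : 'I_(ncomp D)) t => j != Q.1 ->
    turning (curve j) (curve i t) = turning (curve j) (curve i t0)) (nbhs t0)) => j.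
  have [->|jQ] := eqVneq j Q.1; first exact: nearW.
  by apply: filterS (others j jQ).
near=> t => tt0; rewrite /mean_winding (bigD1 Q.1) //= [in RHS](bigD1 Q.1) //=.
have -> : turning (curve Q.1) (curve i t) = turning (curve Q.1) (curve i t0) -
    Num.sg (t - t0) * Num.sg (det2 (tan (circle_pt i t0)) (tan Q)) * (pi *+ 2).
  by move: tt0; near: t.
rewrite (eq_bigr (fun j => turning (curve j) (curve i t0))); last first.
  by move=> j; move: j; near: t.
have : @pi R != 0 by rewrite gt_eqF ?pi_gt0.
by move: (@pi R) => p p0; field.
Unshelve. all: by end_near. Qed.

End WindingNumber.

(** * Sums over the crossings *)

Section CrossingSums.
Variables (R : realType) (D : virtual_link_diagram R).

Local Notation strand := ('I_(ncomp D) * R)%type.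
Local Notation tan := (tangent (@curve R D)).
Local Notation pt := (image_pt (@curve R D)).
Local Notation spair := (strand_pair (@curve R D)).

Let gen := curve_generic D.

Definition strand_pairs : set (strand * strand) := [set PQ | spair PQ.1 PQ.2].

(** Over every double point there are exactly two ordered pairs of strands. *)
Lemma strand_pairs_finite : finite_set strand_pairs.
Proof.
have : strand_pairs `<=` \bigcup_(c in double_point (@curve R D))
    [set PQ | spair PQ.1 PQ.2 /\ pt PQ.1 = c].
  by move=> [P Q] PQ; exists (pt P) => //; exists P, Q.
move=> /sub_finite_set; apply; apply: bigcup_finite; first exact: double_point_finite gen.
move=> _ [P [Q [PQ <-]]]; apply: (@sub_finite_set _ _ [set (P, Q); (Q, P)]); last first.
  exact: finite_set2.
move=> [P' Q'] /= [PQ' E]; have [PP|ne] := pselect (P' = P).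
  by left; rewrite PP in PQ' *; rewrite (no_triple_point gen PQ PQ').
have PP' : spair P P'.
  by case: PQ PQ' => cP _ _ _ [cP' _ _ _]; split=> // /esym.
right; have QP' := no_triple_point gen PQ PP'; rewrite -QP' in PQ' *.
by rewrite (no_triple_point gen PQ' (strand_pair_sym PQ)).
Qed.

Definition pair_seq := finmap.enum_fset (fset_set strand_pairs).

Lemma pair_seq_uniq : uniq pair_seq.
Proof. exact: finmap.fset_uniq. Qed.

Lemma pair_seqP PQ : reflect (spair PQ.1 PQ.2) (PQ \in pair_seq).
Proof.
have := in_fset_set strand_pairs_finite PQ.
rewrite -[X in X = _]/(PQ \in pair_seq) => ->.
by apply: (iffP idP); rewrite in_setE.
Qed.

Definition pair_sign (PQ : strand * strand) : int := sgz (det2 (tan PQ.1) (tan PQ.2)).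

(** Without triple points, a strand at a crossing determines the other one. *)
Lemma sum_strand (V : zmodType) P Q (F : strand * strand -> V) : spair P Q ->
  \sum_(PQ <- pair_seq | PQ.1 == P) F PQ = F (P, Q).
Proof.
move=> PQ; rewrite big_seq_cond.
rewrite (eq_bigl (fun PQ' => (PQ' \in pair_seq) && (PQ' == (P, Q)))); last first.
  move=> [P' Q'] /=; case: (pair_seqP (P', Q')) => //= PQ'.
  rewrite xpair_eqE; case: eqP => //= E; rewrite E in PQ'.
  by rewrite (no_triple_point gen PQ PQ') eqxx.
rewrite -big_seq_cond -big_filter (_ : [seq _ <- _ | _] = [:: (P, Q)]) ?big_seq1 //.
by apply: filter_pred1_uniq; [exact: pair_seq_uniq|exact/pair_seqP].
Qed.

Lemma sum_no_strand (V : zmodType) P (F : strand * strand -> V) : (forall Q, ~ spair P Q) ->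
  \sum_(PQ <- pair_seq | PQ.1 == P) F PQ = 0.
Proof.
move=> none; rewrite big_seq_cond big1 // => -[P' Q] /andP[/pair_seqP /= PQ /eqP PP].
by case: (none Q); rewrite -PP.
Qed.

End CrossingSums.

(** * The index along a long arc *)

Section IndexAlongArc.
Variables (R : realType) (D : virtual_link_diagram R).

Local Notation strand := ('I_(ncomp D) * R)%type.
Local Notation tan := (tangent (@curve R D)).
Local Notation pt := (image_pt (@curve R D)).
Local Notation spair := (strand_pair (@curve R D)).
Local Notation pairs := (pair_seq D).

Let gen := curve_generic D.

Lemma step_shift_near (a t0 : R) : \forall t \near t0, (step (t - a))%:~R =
  (step (t0 - a))%:~R + (t0 - a \is a Num.int)%:R * Num.sg (t - t0) :> R.
Proof.
have ca : {for t0, continuous (fun t : R => t - a)}.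
  by apply: continuousB; [exact: cvg_id|exact: cvg_cst].
have h := ca _ (step_near (t0 - a)).
near=> t; have -> : t - t0 = (t - a) - (t0 - a) by ring.
near: t; exact: h.
Unshelve. all: by end_near. Qed.

(** Adding step functions with jumps opposite to those of the mean winding number
gives a locally constant function of the parameter. *)
Lemma winding_along (i : 'I_(ncomp D)) x y :
  mean_winding D (curve i y) - mean_winding D (curve i x) =
  - \sum_(PQ <- pairs | PQ.1.1 == i)
      (pair_sign PQ)%:~R * (step (y - PQ.1.2) - step (x - PQ.1.2))%:~R / 2.
Proof.
pose F (t : R) (PQ : strand * strand) : R := (pair_sign PQ)%:~R * (step (t - PQ.1.2))%:~R / 2.
pose f t := mean_winding D (curve i t) + \sum_(PQ <- pairs | PQ.1.1 == i) F t PQ.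
suff : f x = f y.
  rewrite /f => E; rewrite -sumrN.
  rewrite (eq_bigr (fun PQ => F x PQ - F y PQ)); last first.
    by move=> PQ _; rewrite /F rmorphB /=; field.
  by rewrite sumrB; lra.
apply: locally_constant => t0.
have steps : \forall t \near t0, forall PQ, PQ \in pairs -> F t PQ = F t0 PQ +
    (pair_sign PQ)%:~R * (t0 - PQ.1.2 \is a Num.int)%:R * Num.sg (t - t0) / 2.
  elim: pairs => [|PQ s IH]; first by near=> t.
  near=> t => PQ'; rewrite inE => /orP[/eqP ->|]; last by move: PQ'; near: t.
  have E : (step (t - PQ.1.2))%:~R = (step (t0 - PQ.1.2))%:~R +
      (t0 - PQ.1.2 \is a Num.int)%:R * Num.sg (t - t0) :> R.
    by near: t; exact: step_shift_near.
  by rewrite /F E; field.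
have change t : (forall PQ, PQ \in pairs -> F t PQ = F t0 PQ +
    (pair_sign PQ)%:~R * (t0 - PQ.1.2 \is a Num.int)%:R * Num.sg (t - t0) / 2) ->
    \sum_(PQ <- pairs | PQ.1.1 == i) F t PQ = \sum_(PQ <- pairs | PQ.1.1 == i) F t0 PQ +
    \sum_(PQ <- pairs | PQ.1 == circle_pt i t0) (pair_sign PQ)%:~R * Num.sg (t - t0) / 2.
  move=> h; rewrite big_mkcond [X in X + _]big_mkcond [X in _ + X]big_mkcond /=.
  rewrite -big_split /= big_seq [RHS]big_seq; apply: eq_bigr => -[[j a] Q] /[dup] inS /pair_seqP /= PQ.
  have [cP _ _ _] := PQ; case: (eqVneq j i) => [ji|ne]; last first.
    by rewrite xpair_eqE (negbTE ne) addr0.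
  rewrite h // ji; congr (_ + _) => /=.
  have -> : ((i, a) == circle_pt i t0) = (t0 - a \is a Num.int).
    rewrite -ji; apply/eqP/intrP => [/circle_ptE[//|_ [k E]]|[k E]].
      by exists k; move: E => /= <-; ring.
    by apply/circle_ptE => //; split=> //; exists k; rewrite /= -E; ring.
  by case: (_ \is a Num.int); rewrite ?mulr1 // mulr0 !mul0r.
have [[Q PQ]|none] := pselect (exists Q, spair (circle_pt i t0) Q).
  have jump := mean_winding_jump PQ.
  near=> t; rewrite /f change; last by near: t.
  rewrite (sum_strand _ PQ) /=; have [->|tt0] := eqVneq t t0.
    by rewrite subrr sgr0 mulr0 mul0r addr0.
  have -> : mean_winding D (curve i t) = mean_winding D (curve i t0) -
    Num.sg (t - t0) * Num.sg (det2 (tan (circle_pt i t0)) (tan Q)) / 2 by move: tt0; near: t.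
  by rewrite /pair_sign /= (sgrEz (det2 _ _)); ring.
have {}none Q : ~ spair (circle_pt i t0) Q by move=> PQ; apply: none; exists Q.
have stable := mean_winding_stable none.
near=> t; rewrite /f change; last by near: t.
rewrite (sum_no_strand _ none) addr0; congr (_ + _); near: t; exact: stable.
Unshelve. all: by end_near. Qed.

Section Arc.
Variable e : long_arc D.
Let i := arc_comp e.

Lemma arc_length : arc_start e < arc_end e /\ arc_end e <= arc_start e + 1.
Proof.
case: e => [a|a] /=; last by rewrite add0r ltr01 lexx.
split; first exact: la_start_end.
rewrite leNgt; apply/negP => lt; apply: (@la_inner _ _ a (la_start a + 1)).
  by rewrite lt andbT ltrDl.
rewrite (curve_periodic gen); exact: la_tail.
Qed.

Definition indicator (A : Prop) : int := (`[< A >] : nat)%:Z.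

(** A virtual passage of the arc lies in its interior, or anywhere if the arc is
closed, and contributes a whole step; a strand at a classical crossing can only
be met at an end and contributes half a step.  An arc that returns to its starting strand has
the two halves from the same strand. *)
Lemma step_along_arc (P Q : strand) : spair P Q -> P.1 = arc_comp e ->
  step (arc_end e - P.2) - step (arc_start e - P.2) =
  indicator (virtual_passage e (P, Q)) *+ 2 +
  (indicator (classical D (pt P) /\ arrives_along P e) +
   indicator (classical D (pt P) /\ leaves_along P e)).
Proof.
move=> PQ iP; have [len1 len2] := arc_length.
set x := arc_start e - P.2; set y := arc_end e - P.2.
have xy : x < y by rewrite /x /y; lra.
have yx : y <= x + 1 by rewrite /x /y; lra.
have ptP (k : int) : curve (arc_comp e) (P.2 + k%:~R) = pt P by rewrite curve_int -iP.
have -> : step y - step x = (Num.ceil y - Num.ceil x) + (Num.floor y - Num.floor x).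
  by rewrite /step; ring.
rewrite ceil_diff // floor_diff // -!/(indicator _).
have eqI (A B : Prop) : (A <-> B) -> indicator A = indicator B.
  by move=> AB; rewrite /indicator; congr (Posz (nat_of_bool _)); exact: asbool_equiv_eq.
have no (A : Prop) : ~ A -> indicator A = 0 by move=> nA; rewrite /indicator asboolF.
have [cl|ncl] := pselect (classical D (pt P)).
  have inner (k : int) : ~ (x < k%:~R < y).
    move=> /andP[k1 k2]; move: cl; rewrite -(ptP k).
    have {}k1 : arc_start e < P.2 + k%:~R by move: k1; rewrite /x; lra.
    have {}k2 : P.2 + k%:~R < arc_end e by move: k2; rewrite /y; lra.
    by case: e k1 k2 => a /= k1 k2; [apply: la_inner; rewrite k1|exact: ca_inner].
  rewrite (no (virtual_passage _ _)) ?mul0rn ?add0r; last by case=> _ [].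
  rewrite addrC; congr (_ + _); apply: eqI; split.
  - move=> [k /andP[xk ky]]; split=> //; split=> //; exists k.
    have [ky'|ky'] := ltP k%:~R y; first by case: (inner k); rewrite xk.
    by move: ky ky'; rewrite /y; lra.
  - move=> [_ [_ [k E]]]; exists k; have -> : k%:~R = y by rewrite /y -E; ring.
    by rewrite xy lexx.
  - move=> [k /andP[xk ky]]; split=> //; split=> //; exists k.
    have [xk'|xk'] := ltP x k%:~R; first by case: (inner k); rewrite xk'.
    by move: xk xk'; rewrite /x; lra.
  - move=> [_ [_ [k E]]]; exists k; have -> : k%:~R = x by rewrite /x -E; ring.
    by rewrite xy lexx.
rewrite (no (_ /\ arrives_along P e)) ?(no (_ /\ leaves_along P e)); [|by case|by case].
rewrite !addr0 mulr2n.
have on : (exists k : int, x <= k%:~R < y) <-> virtual_passage e (P, Q).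
  split.
    move=> [k /andP[xk ky]]; split=> //=; first by split=> //; exists P, Q.
    by split=> //; exists k; apply/andP; split; [move: xk; rewrite /x|move: ky; rewrite /y]; lra.
  case=> _ _ [_ [k /andP[xk ky]]]; exists k; rewrite /= in xk ky.
  by apply/andP; split; rewrite /x /y; lra.
(* A virtual crossing can be at the base point of a closed arc, which is covered
   by y = x + 1. *)
have ends : (forall k : int, k%:~R <> x /\ k%:~R <> y) \/ y = x + 1.
  rewrite /x /y; case: e ptP => a /= ptP; [left=> k|by right; ring].
  split=> E; apply: ncl; rewrite -(ptP k) E addrC subrK; [exact: la_tail|exact: la_head].
have halves : (exists k : int, x < k%:~R <= y) <-> (exists k : int, x <= k%:~R < y).
  case: ends => [ne|yE]; last first.
    split=> _; [exists (Num.ceil x)|exists (Num.floor y)].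
      have /andP[c1 c2] := ceil_itv x; rewrite c2 /= yE.
      by move: c1; rewrite rmorphB /=; lra.
    have /andP[f1 f2] := floor_itv y; rewrite f1 andbT.
    by move: f2; rewrite rmorphD /= yE; lra.
  by split=> -[k /andP[k1 k2]]; exists k; have [/eqP nx /eqP ny] := ne k;
    rewrite ?[x <= _]le_eqVlt ?[_ <= y]le_eqVlt ?k1 ?k2 ?orbT //=;
    rewrite lt_neqAle ?k1 ?k2 ?andbT // eq_sym.
by rewrite (eqI _ _ on) (eqI _ _ (iff_trans halves on)).
Qed.

Lemma virtual_index_sum : virtual_index D e =
  \sum_(PQ <- pairs) pair_sign PQ * indicator (virtual_passage e PQ).
Proof.
have sub : virtual_passage e `<=` @strand_pairs R D by move=> PQ [].
rewrite -fsbig_finite; last exact: strand_pairs_finite.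
rewrite -(@fsbig_widen _ _ _ _ (virtual_passage e) (@strand_pairs R D)) //; last first.
  by move=> PQ [_ nPQ]; rewrite /= /indicator asboolF ?mulr0.
by apply: eq_fsbigr => PQ; rewrite in_setE => vPQ; rewrite /indicator asboolT ?mulr1.
Qed.

(** L is meant to be arrives_along or leaves_along.  An end of the arc is either
the strand a or the strand b of its crossing, according to the sign of the pair
that it begins. *)
Lemma end_sum (L : strand -> long_arc D -> Prop) (t : R) :
  (forall P, L P e <-> P.1 = arc_comp e /\ exists k : int, P.2 + k%:~R = t) ->
  \sum_(c \in classical D)
    ((\1_[set x | exists a b, strands_at c a b /\ L a x] e : int) -
     \1_[set x | exists a b, strands_at c a b /\ L b x] e) =
  \sum_(PQ <- pairs) pair_sign PQ * indicator (classical D (pt PQ.1) /\ L PQ.1 e).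
Proof.
move=> LE; set P0 := circle_pt (arc_comp e) t.
have LP P : circle_point P -> (L P e <-> P = P0).
  by move=> cP; rewrite LE; exact: circle_ptE.
have fin : finite_set (classical D).
  exact: sub_finite_set (@classical_sub _ D) (double_point_finite gen).
have [cl|ncl] := pselect (classical D (pt P0)); last first.
  rewrite [RHS]big_seq [RHS]big1; last first.
    move=> [P Q] inS; have PQ : spair P Q by exact: (pair_seqP (P, Q) inS).
    have [cP _ _ _] := PQ.
    rewrite /indicator asboolF ?mulr0 // => -[clP /(LP P cP) PP].
    by apply: ncl; rewrite -PP.
  apply: fsbig1 => c clc; rewrite !indicE.
  rewrite !memNset ?subrr //= => -[a [b [[ab ac _]]]].
    have [_ cb _ E] := ab; move=> /(LP b cb) bP; apply: ncl.
    by rewrite -bP -E ac.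
  have [ca _ _ _] := ab; move=> /(LP a ca) aP; apply: ncl.
  by rewrite -aP ac.
have cP0 : circle_point P0 by exact: frac_circle.
have [Q0 PQ0] : exists Q, spair P0 Q.
  have [X [Y [XY Xc]]] := classical_sub cl.
  have [->|ne] := pselect (P0 = X); first by exists Y.
  exists X; apply: strand_pair_sym; case: XY => cX _ _ _.
  by split=> // /esym.
have [_ cQ0 _ ptQ] := PQ0.
have RHS_E : \sum_(PQ <- pairs) pair_sign PQ * indicator (classical D (pt PQ.1) /\ L PQ.1 e) =
    sgz (det2 (tan P0) (tan Q0)).
  rewrite -[RHS]/(pair_sign (P0, Q0)) -(sum_strand (@pair_sign R D) PQ0) [RHS]big_mkcond /=.
  rewrite big_seq [RHS]big_seq; apply: eq_bigr => -[P Q] /pair_seqP PQ /=.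
  have [cP _ _ _] := PQ; case: eqP => [->|ne].
    by rewrite /indicator asboolT ?mulr1 //; split=> //; exact/LP.
  by rewrite /indicator asboolF ?mulr0 // => -[_ /(LP P cP)].
rewrite RHS_E fsbig_finite //=.
have term c : classical D c -> (\1_[set x | exists a b, strands_at c a b /\ L a x] e : int) -
     \1_[set x | exists a b, strands_at c a b /\ L b x] e =
     if c == pt P0 then sgz (det2 (tan P0) (tan Q0)) else 0.
  move=> clc; rewrite !indicE; case: eqP => [->|ne]; last first.
    rewrite !memNset ?subrr //= => -[a [b [[ab ac _]]]].
      by have [_ cb _ E] := ab; move=> /(LP b cb) bP; apply: ne; rewrite -bP -E.
    by have [ca _ _ _] := ab; move=> /(LP a ca) aP; apply: ne; rewrite -aP.
  have LP0 : L P0 e by exact/LP.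
  have as_a : e \in [set x | exists a b, strands_at (pt P0) a b /\ L a x] =
      (0 < det2 (tan P0) (tan Q0)).
    apply/idP/idP; rewrite in_setE /=.
      move=> [a [b [[ab _ pos]]]]; have [ca _ _ _] := ab; move=> /(LP a ca) E.
      by move: ab pos; rewrite E => ab; rewrite (no_triple_point gen ab PQ0).
    by move=> pos; exists P0, Q0.
  have as_b : e \in [set x | exists a b, strands_at (pt P0) a b /\ L b x] =
      (det2 (tan P0) (tan Q0) < 0).
    rewrite det2C oppr_lt0; apply/idP/idP; rewrite in_setE /=.
      move=> [a [b [[ab _ pos]]]]; have [_ cb _ _] := ab; move=> /(LP b cb) E.
      move: ab pos; rewrite E => /strand_pair_sym ab.
      by rewrite (no_triple_point gen ab PQ0).
    by move=> pos; exists Q0, P0; split=> //; split=> //; exact: strand_pair_sym.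
  by rewrite as_a as_b; case: sgzP.
set s := finmap.enum_fset _.
have sP c : c \in s -> classical D c.
  have := in_fset_set fin c; rewrite -[X in X = _]/(c \in s) => ->.
  by rewrite in_setE.
have P0s : pt P0 \in s.
  have := in_fset_set fin (pt P0); rewrite -[X in X = _]/(_ \in s) => ->.
  by rewrite in_setE.
rewrite big_seq (eq_bigr _ (fun c cs => term c (sP c cs))) -big_seq -big_mkcond /=.
rewrite -big_filter (_ : [seq _ <- _ | _] = [:: pt P0]) ?big_seq1 //.
by apply: filter_pred1_uniq => //; exact: finmap.fset_uniq.
Qed.

(** The sum of the expressions in beta_l and in beta_r treats both ends alike. *)
Lemma canonical_index_sum : canonical_index D e *+ 2 =
  - \sum_(PQ <- pairs) pair_sign PQ *
     (indicator (classical D (pt PQ.1) /\ arrives_along PQ.1 e) +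
      indicator (classical D (pt PQ.1) /\ leaves_along PQ.1 e)).
Proof.
under eq_bigr do rewrite mulrDr.
rewrite big_split /= -(end_sum (L := @arrives_along R D) (t := arc_end e)) //.
rewrite -(end_sum (L := @leaves_along R D) (t := arc_start e)) //.
rewrite mulr2n [X in X + _]canonical_index_r /canonical_index.
have fin : finite_set (classical D).
  exact: sub_finite_set (@classical_sub _ D) (double_point_finite gen).
rewrite !fsbig_finite // -!big_split -sumrN /=; apply: eq_bigr => c _.
rewrite /beta_l /beta_r; ring.
Qed.

Lemma index_difference :
  mean_winding D (curve i (arc_end e)) - mean_winding D (curve i (arc_start e)) =
  (canonical_index D e - virtual_index D e)%:~R.
Proof.
rewrite winding_along.
suff : \sum_(PQ <- pairs | PQ.1.1 == i) pair_sign PQ *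
     (step (arc_end e - PQ.1.2) - step (arc_start e - PQ.1.2)) =
     virtual_index D e *+ 2 - canonical_index D e *+ 2.
  move=> /(congr1 (fun k : int => k%:~R : R)); rewrite rmorph_sum /= => E.
  rewrite -mulr_suml (eq_bigr (fun PQ => (pair_sign PQ *
     (step (arc_end e - PQ.1.2) - step (arc_start e - PQ.1.2)))%:~R)); last first.
    by move=> PQ _; rewrite intrM.
  by rewrite E -mulrnBl rmorphMn rmorphB /=; field.
rewrite canonical_index_sum virtual_index_sum opprK -sumrMnl -big_split /= big_mkcond /=.
rewrite [LHS]big_seq [RHS]big_seq; apply: eq_bigr => -[P Q] /pair_seqP PQ.
case: eqP => /= iP; first by rewrite (step_along_arc PQ iP) -mulrnAr -mulrDr.
have out (A : Prop) : (A -> P.1 = arc_comp e) -> indicator A = 0.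
  by move=> h; rewrite /indicator asboolF // => /h.
rewrite !out ?mulr0 ?mul0rn ?addr0 //.
all: by [case=> _ []|case=> _ _ []].
Qed.

End Arc.

End IndexAlongArc.

Theorem theorem1 (R : realType) (D : virtual_link_diagram R) :
  (exists g : cochain0 (covering_graph D),
     canonical_index D - virtual_index D = coboundary g) /\
  H1_class (canonical_index D) = virtual_index_class D.
Proof.
pose g : cochain0 (covering_graph D) :=
  fun c : crossing D => Num.floor (mean_winding D (sval c)).
have gE : canonical_index D - virtual_index D = coboundary g.
  apply/funext => e; rewrite /coboundary.
  change ((canonical_index D - virtual_index D) e) with (canonical_index D e - virtual_index D e).
  have := index_difference e; set n := _ - virtual_index D e; case: e @n => [a|a] n /= E.
    rewrite /g /=; have -> : mean_winding D (curve (la_comp a) (la_end a)) =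
      mean_winding D (curve (la_comp a) (la_start a)) + n%:~R by rewrite -E addrC subrK.
    by rewrite floorDrz ?intr_int // intrKfloor addrAC subrr add0r.
  apply/eqP; rewrite -(eqr_int R) -E.
  by have := curve_periodic (curve_generic D) (ca_comp a) 0; rewrite add0r => ->; rewrite subrr.
split; first by exists g.
have coboundaryD (h k : cochain0 (covering_graph D)) :
    coboundary (h + k) = coboundary h + coboundary k.
  apply/funext => e; rewrite -[RHS]/(coboundary h e + coboundary k e) /coboundary.
  case: (ends e) => [[u v]|]; last by rewrite addr0.
  by rewrite -[(h + k) v]/(h v + k v) -[(h + k) u]/(h u + k u) opprD addrACA.
have coboundaryB (h k : cochain0 (covering_graph D)) :
    coboundary (h - k) = coboundary h - coboundary k.
  apply/funext => e; rewrite -[RHS]/(coboundary h e - coboundary k e) /coboundary.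
  case: (ends e) => [[u v]|]; last by rewrite subr0.
  by rewrite -[(h - k) v]/(h v - k v) -[(h - k) u]/(h u - k u) !opprB addrACA [- k v - _]addrC addrACA.
apply/seteqP; split=> v [h hE].
  by exists (h + g); rewrite coboundaryD -hE -gE addrA subrK.
by exists (h - g); rewrite coboundaryB -hE -gE opprB addrA subrK.
Qed.
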